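(* Let $(X,\rho,\mu)$ be a space of homogeneous type (a quasimetric measure space whose measure $\mu$ satisfies the doubling condition), and let $\nu$ be another measure on $X$. Let $1<p<q<\infty$, $0<\alpha<1/p$, $0<\lambda_1<1-\alpha p$ and $\lambda_2/q=\lambda_1/p$. Then the operator $K_\alpha$ is bounded from $L^{p,\lambda_1}(X,\mu)$ to $L^{q,\lambda_2}(X,\nu,\mu)$ if and only if there is a positive constant $c$ such that $$\nu(B)\le c\,\mu(B)^{q(1/p-\alpha)}$$ for all balls $B$ in $X$.
   Context: A quasimetric measure space $(X,\rho,\mu)$: $X$ is a topological space with a complete measure $\mu$ such that compactly supported continuous functions are dense in $L^1(X,\mu)$, and $\rho:X\times X\to[0,\infty)$ satisfies: $\rho(x,y)>0$ for $x\ne y$ and $\rho(x,x)=0$; $\rho(x,y)\le a_0\rho(y,x)$ for some constant $a_0\ge1$; $\rho(x,y)\le a_1(\rho(x,z)+\rho(z,y))$ for some constant $a_1\ge1$. Balls $B(a,r)=\{x\in X:\rho(x,a)<r\}$ are measurable with $0\le\mu(B(a,r))<\infty$; every neighborhood of $x$ contains some ball $B(x,r)$; $\mu(X)=\infty$, $\mu\{a\}=0$ for all $a$, and $B(a,r_2)\setminus B(a,r_1)\neq\emptyset$ for all $a\in X$, $0<r_1<r_2<\infty$. The doubling condition: $\mu(B(a,2r))\le C_1\mu(B(a,r))$ for some $C_1>1$ and all $a\in X$, $r>0$. For $0<\alpha<1$, $K_\alpha f(x)=\int_X f(y)\,\mu(B(x,\rho(x,y)))^{\alpha-1}\,d\mu(y)$.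 For a measure $\nu$ on $X$, $\lambda\ge0$, $1\le p<\infty$, the Morrey space $L^{p,\lambda}(X,\nu,\mu)$ is the set of $f\in L^p_{\rm loc}(X,\nu)$ with $\|f\|_{L^{p,\lambda}(X,\nu,\mu)}=\sup_B\big(\mu(B)^{-\lambda}\int_B|f|^p\,d\nu\big)^{1/p}<\infty$, the supremum over all balls $B$; $L^{p,\lambda}(X,\mu):=L^{p,\lambda}(X,\mu,\mu)$. Boundedness means $\|K_\alpha f\|_{L^{q,\lambda_2}(X,\nu,\mu)}\le C\|f\|_{L^{p,\lambda_1}(X,\mu)}$ for all $f$ with a constant $C$ independent of $f$. *)

(* Defs.v *)
From HB Require Import structures.
From mathcomp Require Import all_boot all_order all_algebra.
From mathcomp Require Import all_classical all_reals all_analysis.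
Set Implicit Arguments. Unset Strict Implicit. Unset Printing Implicit Defensive.
Import Order.TTheory GRing.Theory Num.Theory numFieldNormedType.Exports.
Local Open Scope classical_set_scope.
Local Open Scope ring_scope.

Section Defs.
Context {d : measure_display} {T : measurableType d} {R : realType}.

Definition qball (rho : T -> T -> R) (a : T) (r : R) : set T :=
  [set x | rho x a < r].

Definition is_topology (op : set (set T)) : Prop :=
  [/\ op set0, op setT,
      (forall A B, op A -> op B -> op (A `&` B)) &
      (forall F : set (set T), F `<=` op -> op (\bigcup_(A in F) A))].

Definition op_continuous (op : set (set T)) (f : T -> R) : Prop :=
  forall U : set R, open U -> op (f @^-1` U).

Definition op_closure (op : set (set T)) (A : set T) : set T :=
  [set x | forall U, op U -> U x -> U `&` A !=set0].

Definition op_compact (op : set (set T)) (K : set T) : Prop :=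
  forall F : set (set T), F `<=` op -> K `<=` \bigcup_(A in F) A ->
    exists G : set (set T), [/\ G `<=` F, finite_set G & K `<=` \bigcup_(A in G) A].

Definition op_Cc (op : set (set T)) (g : T -> R) : Prop :=
  op_continuous op g /\ op_compact op (op_closure op [set x | g x != 0]).

Definition Cc_dense_L1 (op : set (set T)) (mu : {measure set T -> \bar R}) : Prop :=
  forall f : T -> R, measurable_fun setT f -> mu.-integrable setT (EFin \o f) ->
  forall e : R, 0 < e ->
  exists g : T -> R, [/\ measurable_fun setT g, op_Cc op g &
    (\int[mu]_x (`|f x - g x|)%:E < e%:E)%E].

Definition homogeneous_type (op : set (set T)) (rho : T -> T -> R)
    (mu : {measure set T -> \bar R}) : Prop :=
  is_topology op /\
  measure_is_complete mu /\
  Cc_dense_L1 op mu /\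
  (forall x y, 0 <= rho x y) /\ (forall x, rho x x = 0) /\
  (forall x y, x != y -> 0 < rho x y) /\
  (exists a0 : R, 1 <= a0 /\ forall x y, rho x y <= a0 * rho y x) /\
  (exists a1 : R, 1 <= a1 /\
     forall x y z, rho x y <= a1 * (rho x z + rho z y)) /\
  (forall a r, measurable (qball rho a r) /\ (mu (qball rho a r) < +oo)%E) /\
  (forall x U, op U -> U x -> exists2 r, 0 < r & qball rho x r `<=` U) /\
  (mu setT = +oo)%E /\ (forall a, mu [set a] = 0%E) /\
  (forall a r1 r2, 0 < r1 -> r1 < r2 ->
     qball rho a r2 `\` qball rho a r1 !=set0) /\
  (exists C1 : R, 1 < C1 /\
    forall a r, 0 < r ->
      (mu (qball rho a (2 * r)) <= C1%:E * mu (qball rho a r))%E).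

Definition K_alpha (rho : T -> T -> R) (mu : {measure set T -> \bar R})
    (alpha : R) (f : T -> R) (x : T) : \bar R :=
  (\int[mu]_y (f y * fine (mu (qball rho x (rho x y))) `^ (alpha - 1))%:E)%E.

Definition morrey_norm (rho : T -> T -> R) (nu mu : {measure set T -> \bar R})
    (p lam : R) (f : T -> \bar R) : \bar R :=
  ereal_sup [set v | exists a r, 0 < r /\
     v = poweR ((fine (mu (qball rho a r)) `^ (- lam))%:E *
                \int[nu]_(x in qball rho a r) poweR `|f x| p)%E p^-1].

Definition K_alpha_bounded (rho : T -> T -> R) (nu mu : {measure set T -> \bar R})
    (alpha p lam1 q lam2 : R) : Prop :=
  exists C : R, forall f : T -> R,
    measurable_fun setT f ->
    (morrey_norm rho mu mu p lam1 (EFin \o f) < +oo)%E ->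
    (morrey_norm rho nu mu q lam2 (K_alpha rho mu alpha f)
       <= C%:E * morrey_norm rho mu mu p lam1 (EFin \o f))%E.

End Defs.

(* Main.v *)
(** Idea. Necessity follows by testing the operator on indicators of balls.
For sufficiency, fix a ball [B = B(a, r)] and [x] in [B], and cut the potential
into the annuli [t <= rho y x < M t] around [x], with [t = r M^k] for integers
[k]; an annulus contributes at most a multiple of
[mu(B(x, t))^(alpha - 1/p) (int_(B(x, M t)) |f|^p)^(1/p)].
For [k >= 0] the Morrey bound gives a geometric series, because the mass of
balls grows geometrically (reverse doubling) and [lam1 < 1 - alpha p].
For [k < 0] only the part [1/p - 1/q] of the exponent [1/p] is spent on the
Morrey bound. Since [lam1 > 0] this leaves room to sum in [k], and the [q]-th
power of the near part is dominated by
[sum_k mu(B(x, t))^e int_(B(x, M t)) |f|^p], whose [nu]-integral over [B] is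
controlled by the growth condition on [nu]. Hence the trace inequality for
[L^p] functions, and with it maximal functions and interpolation, is not
needed.

Nothing makes [rho] measurable in its second variable, or jointly, so
[K_alpha f] and the dominating sum need not be measurable, and their integrals
are lower integrals. They are compared with measurable majorants, built from
covers of a ball by finitely many small balls. *)

Require Import Defs.
From HB Require Import structures.
From mathcomp Require Import all_boot all_order all_algebra.
From mathcomp Require Import all_classical all_reals all_analysis.
From mathcomp Require Import measurable_realfun ring lra.
Import Order.TTheory GRing.Theory Num.Theory.
Local Open Scope classical_set_scope.
Local Open Scope ring_scope.

Set Implicit Arguments. Unset Strict Implicit. Unset Printing Implicit Defensive.

(** * Quasimetric balls under doubling *)

(** The two quasimetric constants are merged into [K]: [ds_tri] accepts the arguments of [rho] in
    either order, and doubling is stated for dilation by [K]. A change of centre then costs one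
    factor [K] in the radius and one factor [D] in the mass. *)
Record doubling_space {R : realType} {d : measure_display}
    {T : measurableType d} (rho : T -> T -> R) (mu : {measure set T -> \bar R})
    (K D : R) : Prop := DoublingSpace {
  ds_K : 2 <= K;
  ds_D : 1 <= D;
  ds_ge0 : forall x y, 0 <= rho x y;
  ds_refl : forall x, rho x x = 0;
  ds_gt0 : forall x y, x != y -> 0 < rho x y;
  ds_tri : forall x y z r, rho x z < r \/ rho z x < r ->
    rho z y < r \/ rho y z < r -> rho x y < K * r;
  ds_meas : forall a r, measurable (qball rho a r);
  ds_fin : forall a r, mu (qball rho a r) \is a fin_num;
  ds_pos : forall a r, 0 < r -> 0 < fine (mu (qball rho a r));
  ds_dbl : forall a r, 0 < r ->
    fine (mu (qball rho a (K * r))) <= D * fine (mu (qball rho a r));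
  ds_annulus : forall a r1 r2, 0 < r1 -> r1 < r2 ->
    qball rho a r2 `\` qball rho a r1 !=set0 }.

Section Homogeneous.
Context {R : realType} {d : measure_display} {T : measurableType d}.
Context (op : set (set T)) (rho : T -> T -> R) (mu : {measure set T -> \bar R}).

(** By doubling, a null ball has null dilates by all powers of 2. These exhaust the space, whose
    mass is infinite. *)
Lemma homogeneous_ball_gt0 (C : R) :
  (forall x, rho x x = 0) -> (forall x y, 0 <= rho x y) ->
  (forall a r, measurable (qball rho a r)) ->
  (mu setT = +oo)%E ->
  (forall a r, 0 < r ->
     (mu (qball rho a (2 * r)) <= C%:E * mu (qball rho a r))%E) ->
  forall a r, 0 < r -> (0 < mu (qball rho a r))%E.
Proof.
move=> r0 rge0 mB muT dbl a r rgt0; rewrite lt0e measure_ge0 andbT.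
apply/negP => /eqP B0.
have Bn0 n : mu (qball rho a (2 ^+ n * r)) = 0%E.
  elim: n => [|n IH]; first by rewrite expr0 mul1r.
  apply/eqP; rewrite eq_le measure_ge0 andbT exprS -mulrA.
  apply: le_trans (dbl _ _ _) _; first by rewrite mulr_gt0 ?exprn_gt0.
  by rewrite IH mule0.
suff : (mu setT <= 0)%E by rewrite muT.
have -> : [set: T] = \bigcup_n qball rho a (2 ^+ n * r).
  apply/seteqP; split => // x _.
  have [n hn] : exists n, rho x a / r < 2 ^+ n.
    exists (Num.bound (rho x a / r)); apply: lt_trans (archi_boundP _) _.
      by rewrite divr_ge0 // ltW.
    by rewrite -natrX ltr_nat ltn_expl.
  by exists n => //=; rewrite /qball /= -ltr_pdivrMr.
apply: le_trans (measure_sigma_subadditive _ _ _ (@subset_refl _ _)) _ => //.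
- exact: bigcup_measurable.
- by rewrite eseries0.
Qed.

(** Take [K = 2 * a0 * a1], which absorbs one swap of arguments and one triangle inequality, and
    [D = C1 ^+ n] with [K <= 2 ^+ n]. *)
Lemma homogeneous_doubling_space : homogeneous_type op rho mu ->
  exists K D : R, doubling_space rho mu K D.
Proof.
move=> [_ [_ [_ [rge0 [r0 [rgt0 [[a0 [a01 ha0]] [[a1 [a11 ha1]] H]]]]]]]].
move: H => [mB [_ [muT [_ [ann [C1 [C11 dbl]]]]]]].
have pos := homogeneous_ball_gt0 r0 rge0 (fun a r => (mB a r).1) muT dbl.
have fin a r : mu (qball rho a r) \is a fin_num.
  by rewrite ge0_fin_numE // (mB a r).2.
have Cn0 n : 0 <= C1 ^+ n by rewrite exprn_ge0 //; lra.
have K2 : 2 <= 2 * a0 * a1.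
  have : 0 <= (a0 - 1) * (a1 - 1) by apply: mulr_ge0; lra.
  nra.
have [n hn] : exists n, 2 * a0 * a1 <= 2 ^+ n.
  exists (Num.bound (2 * a0 * a1)).
  apply: ltW; apply: lt_trans (archi_boundP _) _; first by lra.
  by rewrite -natrX ltr_nat ltn_expl.
exists (2 * a0 * a1), (C1 ^+ n); split => //.
- by rewrite exprn_ege1 // ltW.
- move=> x y z r hx hy.
  have sym u v : rho u v < r \/ rho v u < r -> rho u v < a0 * r.
    move=> [h|h]; have := ha0 u v; have := rge0 u v; have := rge0 v u; first by nra.
    have : a0 * rho v u < a0 * r by rewrite ltr_pM2l //; lra.
    lra.
  have h1 := sym _ _ hx; have h2 := sym _ _ hy; have h3 := ha1 x y z.
  apply: le_lt_trans h3 _.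
  have -> : 2 * a0 * a1 * r = a1 * (a0 * r + a0 * r) by ring.
  rewrite ltr_pM2l; lra.
- by move=> a r; have [] := mB a r.
- by move=> a r rp; rewrite fine_gt0 // pos //= ltey_eq fin.
- move=> a r rp.
  have it k : fine (mu (qball rho a (2 ^+ k * r))) <=
      C1 ^+ k * fine (mu (qball rho a r)).
    elim: k => [|k IH]; first by rewrite !expr0 !mul1r.
    rewrite exprS -mulrA.
    have p2 : 0 < 2 ^+ k * r by rewrite mulr_gt0 // exprn_gt0.
    have := dbl a _ p2.
    rewrite -(fineK (fin a (2 * _))) -(fineK (fin a (2 ^+ k * r))) -EFinM lee_fin.
    move=> h; apply: le_trans h _; rewrite exprS -mulrA ler_wpM2l //; lra.
  apply: le_trans (it n).
  apply: fine_le => //; apply: le_measure; rewrite ?inE; try exact: (mB _ _).1.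
  by move=> x /lt_le_trans; apply; rewrite ler_pM2r.
Qed.
End Homogeneous.

Section Geometry.
Context {R : realType} {d : measure_display} {T : measurableType d}.
Context (rho : T -> T -> R) (mu : {measure set T -> \bar R}) (K D : R).
Hypothesis hD : doubling_space rho mu K D.

Notation B := (qball rho).
Definition ball_mass (a : T) (r : R) : R := fine (mu (qball rho a r)).
Notation m := ball_mass.

Lemma ds_K0 : 0 < K. Proof. by have := ds_K hD; lra. Qed.
Lemma ds_K1 : 1 <= K. Proof. by have := ds_K hD; lra. Qed.
Lemma ds_D0 : 0 < D. Proof. by have := ds_D hD; lra. Qed.

Lemma ball_massE a r : mu (B a r) = (m a r)%:E.
Proof. by rewrite fineK // (ds_fin hD). Qed.

Lemma ball_mass_gt0 a r : 0 < r -> 0 < m a r.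
Proof. exact: (ds_pos hD). Qed.

Lemma ball_mass_ge0 a r : 0 <= m a r.
Proof. by rewrite fine_ge0. Qed.

Lemma ball_mass_sub a b r s : B a r `<=` B b s -> m a r <= m b s.
Proof.
move=> sub; rewrite -lee_fin -!ball_massE; apply: le_measure => //;
  by rewrite inE; exact: (ds_meas hD).
Qed.

Lemma ball_sub a r s : r <= s -> B a r `<=` B a s.
Proof. by move=> rs x /lt_le_trans; apply. Qed.

Lemma ball_mass_le a r s : r <= s -> m a r <= m a s.
Proof. by move=> rs; apply/ball_mass_sub/ball_sub. Qed.

Lemma ball_shift a z r : rho a z < r \/ rho z a < r -> B a r `<=` B z (K * r).
Proof. by move=> h x hx; apply: (ds_tri hD) h; left. Qed.

Lemma ball_mass_shift a z r : rho a z < r \/ rho z a < r -> m a r <= m z (K * r).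
Proof. by move=> h; apply/ball_mass_sub/ball_shift. Qed.

Lemma ball_mass_dbl n a r : 0 < r -> m a (K ^+ n * r) <= D ^+ n * m a r.
Proof.
move=> r0; elim: n => [|n IH]; first by rewrite !expr0 !mul1r.
have := ds_dbl hD a (r := K ^+ n * r) (mulr_gt0 (exprn_gt0 _ ds_K0) r0).
rewrite mulrA -exprS => /le_trans; apply; rewrite exprS -mulrA ler_wpM2l //.
exact: ltW ds_D0.
Qed.

Lemma Kexp_ge1 n : 1 <= K ^+ n.
Proof. by rewrite exprn_ege1 // ds_K1. Qed.

Lemma ball_mass_compare a z r : 0 < r -> rho a z < r \/ rho z a < r ->
  m a r <= D * m z r.
Proof.
move=> r0 h; apply: le_trans (ball_mass_shift h) _.
by have := ball_mass_dbl 1 z r0; rewrite !expr1.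
Qed.

(** The larger ball of [reverse_doubling] contains, besides the given ball, a disjoint one with at
    least [(D ^+ 3)^-1] times its mass. *)
Definition rd_const : R := (1 + (D ^+ 3)^-1)^-1.

Lemma rd_const_gt0 : 0 < rd_const.
Proof. by rewrite invr_gt0 addr_gt0 // invr_gt0 exprn_gt0 // ds_D0. Qed.

Lemma rd_const_lt1 : rd_const < 1.
Proof. by rewrite invf_lt1 ?addr_gt0 // ?invr_gt0 ?ltrDl ?invr_gt0 exprn_gt0 // ds_D0. Qed.

(* An annulus contains a point [z] whose ball of radius [r] misses [B a r] and
   has comparable mass, so the mass grows by a definite factor. *)
Lemma reverse_doubling a r : 0 < r -> m a r <= rd_const * m a (K ^+ 3 * r).
Proof.
move=> r0; have K0 := ds_K0; have K1 := ds_K1; have K2 := ds_K hD.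
(* The inner radius [K * r] keeps [B z r] away from [B a r]; the outer radius [K ^+ 2 * r] keeps it
   inside the dilate by [K ^+ 3]. *)
have [z [hz2 hz1]] := ds_annulus hD a (r1 := K * r) (r2 := K ^+ 2 * r)
  ltac:(by rewrite mulr_gt0) ltac:(by rewrite ltr_pM2r // expr2 ltr_pMr //; lra).
have dis : B a r `&` B z r = set0.
  apply/seteqP; split => // w [wa wz]; apply: hz1.
  by apply: (ds_tri hD) (or_introl wa); right.
have sa : B a r `<=` B a (K ^+ 3 * r).
  by apply: ball_sub; rewrite ler_peMl // ?Kexp_ge1 // ltW.
have sz : B z r `<=` B a (K ^+ 3 * r).
  apply: (@subset_trans _ (B z (K ^+ 2 * r))).
    by apply: ball_sub; rewrite ler_peMl // ?Kexp_ge1 // ltW.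
  by rewrite (exprS _ 2) -mulrA; apply: ball_shift; left.
have mBa x s := ds_meas hD x s.
have add : m a r + m z r <= m a (K ^+ 3 * r).
  rewrite -lee_fin EFinD -!ball_massE -measureU //.
  apply: le_measure; rewrite ?inE //; first exact: measurableU.
  by rewrite subUset.
have lowz : m a r <= D ^+ 3 * m z r.
  apply: le_trans (ball_mass_dbl 3 z r0).
  apply: (@le_trans _ _ (m a (K ^+ 2 * r))).
    by apply: ball_mass_le; rewrite ler_peMl // ?Kexp_ge1 // ltW.
  by rewrite (exprS _ 2) -mulrA; apply: ball_mass_shift; right.
rewrite /rd_const mulrC ler_pdivlMr; last by rewrite addr_gt0 // invr_gt0 exprn_gt0 // ds_D0.
rewrite mulrDr mulr1; apply: le_trans add; rewrite lerD2l.
by rewrite ler_pdivrMr ?exprn_gt0 ?ds_D0 // mulrC.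
Qed.

Lemma reverse_doubling_iter n a r : 0 < r ->
  m a r <= rd_const ^+ n * m a ((K ^+ 3) ^+ n * r).
Proof.
move=> r0; elim: n => [|n IH]; first by rewrite !expr0 !mul1r.
apply: le_trans IH _; rewrite (exprSr rd_const n) -mulrA ler_pM2l ?exprn_gt0 ?rd_const_gt0 //.
rewrite (exprS (K ^+ 3) n) -mulrA; apply: reverse_doubling.
by rewrite mulr_gt0 // !exprn_gt0 // ds_K0.
Qed.

End Geometry.

(** * Finite covers of balls by small balls *)

Section Cover.
Context {R : realType} {d : measure_display} {T : measurableType d}.
Context (rho : T -> T -> R) (mu : {measure set T -> \bar R}) (K D : R).
Hypothesis hD : doubling_space rho mu K D.
Notation B := (qball rho).
Notation m := (ball_mass rho mu).

(* Otherwise one finds arbitrarily many points of the ball at mutual distance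
   at least [s]; the balls of radius [s / K] around them are disjoint, lie in a
   fixed ball of finite mass and have mass bounded below. *)
Lemma finite_cover a r s : 0 < s -> exists l : seq T,
  (forall c, c \in l -> rho c a < r) /\
  (forall y, rho y a < r -> exists2 c, c \in l & rho y c < s).
Proof.
move=> s0; apply: contrapT => hn.
have K0 := ds_K0 hD; have K1 := ds_K1 hD; have D0 := ds_D0 hD.
have next (l : seq T) : (forall c, c \in l -> rho c a < r) ->
    exists2 z, rho z a < r & forall c, c \in l -> s <= rho z c.
  move=> hl; apply: contrapT => hz; apply: hn; exists l; split => // y ya.
  apply: contrapT => hy; apply: hz; exists y => // c cl.
  by rewrite leNgt; apply/negP => yc; apply: hy; exists c.
(* Nothing relates [r] to [s]; with the maximum, the small balls centred in [B a r] all lie in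
   [B a (K * S)]. *)
pose S := Num.max r s.
have S0 : 0 < S by rewrite lt_max s0 orbT.
have rS : r <= S by rewrite le_max lexx.
have sS : s <= S by rewrite le_max lexx orbT.
have sK0 : 0 < s / K by rewrite divr_gt0.
have sKs : s / K <= s by rewrite ler_pdivrMr // ler_peMr // ltW.
have [j hj] : exists j, K * S <= K ^+ j * (s / K).
  have [j hj] : exists j, K * S / (s / K) < K ^+ j.
    exists (Num.bound (K * S / (s / K))); apply: lt_le_trans (archi_boundP _) _.
      by apply: ltW; rewrite divr_gt0 // mulr_gt0.
    apply: (@le_trans _ _ (2 ^+ Num.bound (K * S / (s / K)))).
      by rewrite -natrX ler_nat ltnW // ltn_expl.
    by apply: lerXn2r; rewrite ?nnegrE ?(ltW K0) // (ds_K hD).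
  by exists j; rewrite -ler_pdivrMr // ltW.
(* A lower bound for the mass of any ball of radius [s / K] centred in [B a r], since its dilate by
   [K ^+ j] contains [B a S]. *)
pose c0 := m a S / D ^+ j.
have c0gt0 : 0 < c0 by rewrite divr_gt0 ?exprn_gt0 // (ball_mass_gt0 hD).
have build n : exists (l : seq T) (U : set T), [/\
    forall c, c \in l -> rho c a < r, measurable U, U `<=` B a (K * S),
    forall w, U w -> exists2 c, c \in l & rho w c < s / K &
    ((n%:R * c0)%:E <= mu U)%E].
  elim: n => [|n [l [U [hl mU US Ul hU]]]].
    by exists [::], set0; split => //; rewrite measure0 mul0r.
  have [z za zl] := next l hl.
  have mz : measurable (B z (s / K)) by exact: (ds_meas hD).
  exists (z :: l), (U `|` B z (s / K)); split.
  - by move=> c; rewrite inE => /predU1P[->|/hl].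
  - exact: measurableU.
  - rewrite subUset; split => // w wz; apply: (ds_tri hD (z := z)).
      by left; apply: lt_le_trans wz _; exact: le_trans sKs sS.
    by left; apply: lt_le_trans rS.
  - move=> w [/Ul [c cl wc]|wz]; last by exists z; rewrite ?inE ?eqxx.
    by exists c => //; rewrite inE cl orbT.
  have UB0 : U `&` B z (s / K) = set0.
    apply/seteqP; split => // w [/Ul [c cl wc] wz].
    have := ds_tri hD (or_intror wz) (or_introl wc).
    by rewrite mulrCA divff ?gt_eqF // mulr1 ltNge zl.
  rewrite measureU // -natr1 mulrDl mul1r EFinD leeD //.
  apply: (@le_trans _ _ (m z (s / K))%:E); last by rewrite -(ball_massE hD).
  rewrite lee_fin.
  rewrite ler_pdivrMr ?exprn_gt0 // mulrC; apply: le_trans (ball_mass_dbl hD _ _ _) => //.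
  apply: le_trans (ball_mass_shift hD _) (ball_mass_le hD _ hj).
  by right; apply: lt_le_trans rS.
have [n hn'] : exists n : nat, m a (K * S) / c0 < n%:R.
  by exists (Num.bound (m a (K * S) / c0)); rewrite archi_boundP // divr_ge0 ?ball_mass_ge0 // ltW.
have [l [U [_ mU US _ hU]]] := build n.
have : ((n%:R * c0)%:E <= mu (B a (K * S)))%E.
  by apply: le_trans hU _; apply: le_measure; rewrite ?inE //; exact: (ds_meas hD).
by rewrite (ball_massE hD) lee_fin -ler_pdivlMr // leNgt hn'.
Qed.

End Cover.

(** * Lower integrals and measurable majorants *)

Section LowerIntegral.
Local Open Scope ereal_scope.
Context {R : realType} {d : measure_display} {T : measurableType d}.
Variable mu : {measure set T -> \bar R}.

(* The integral of a nonnegative function is a supremum over simple functions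
   below it, so it is monotone even without measurability. *)
Lemma le_lower_integral (A : set T) (f g : T -> \bar R) :
  (forall x, A x -> 0 <= f x) -> (forall x, A x -> f x <= g x) ->
  \int[mu]_(x in A) f x <= \int[mu]_(x in A) g x.
Proof.
move=> f0 fg; have g0 x : A x -> 0 <= g x.
  by move=> Ax; exact: le_trans (f0 x Ax) (fg x Ax).
rewrite !ge0_integralE //; apply: ge_ereal_sup => _ [h /= hf <-].
apply: ereal_sup_ubound; exists h => //= x; apply: le_trans (hf x) _.
exact: lee_restrict.
Qed.

(** The integrals of the positive and negative parts both lie between 0 and that of [g], hence so
    does the absolute value of their difference; if both are infinite, so is the right-hand side. *)
Lemma abse_lower_integral_le (f g : T -> \bar R) : (forall x, `|f x| <= g x) ->
  `|\int[mu]_x f x| <= \int[mu]_x g x.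
Proof.
move=> fg; rewrite integralE.
have hp : \int[mu]_x f^\+ x <= \int[mu]_x g x.
  apply: le_lower_integral => x _; first exact: funepos_ge0.
  apply: le_trans (fg x); rewrite funeposE ge_max abse_ge0 andbT.
  exact: lee_abs.
have hn : \int[mu]_x f^\- x <= \int[mu]_x g x.
  apply: le_lower_integral => x _; first exact: funeneg_ge0.
  apply: le_trans (fg x); rewrite funenegE ge_max abse_ge0 andbT.
  by rewrite -abseN; exact: lee_abs.
have p0 : 0 <= \int[mu]_x f^\+ x by apply: integral_ge0 => x _; exact: funepos_ge0.
have n0 : 0 <= \int[mu]_x f^\- x by apply: integral_ge0 => x _; exact: funeneg_ge0.
move: hp hn p0 n0.
case: (\int[mu]_x f^\+ x) => [a| |]; case: (\int[mu]_x f^\- x) => [b| |];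
  case: (\int[mu]_x g x) => [c| |] //=; rewrite ?leey // !lee_fin.
by move=> *; apply/ler_normlP; split; lra.
Qed.

End LowerIntegral.

Section Discretize.
Local Open Scope ereal_scope.
Context {R : realType} {d : measure_display} {T : measurableType d}.
Variables mu nu : {measure set T -> \bar R}.

Lemma ge0_integral_setID (phi : T -> \bar R) (A E : set T) :
  measurable A -> measurable E -> measurable_fun setT phi ->
  (forall x, 0 <= phi x) ->
  \int[mu]_(x in E) phi x =
  \int[mu]_(x in E `&` A) phi x + \int[mu]_(x in E `\` A) phi x.
Proof.
move=> mA mE mphi phi0.
rewrite -[in LHS](setUIDK E A) ge0_integral_setU //.
- exact: measurableI.
- exact: measurableD.
- exact: measurable_funTS.
- by rewrite disj_set2E; apply/eqP; apply/seteqP; split => // x [[_ ?] []].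
Qed.

(* The function [x |-> u x * int_(E & V x) phi] need not be measurable because
   the sets [V x] are not assumed to form a measurable subset of the product.
   Cutting [E] into finitely many pieces gives a measurable majorant. *)
Lemma discretize (l : seq T) (Q W V : T -> set T) (c u : T -> R) (H : \bar R)
    (phi : T -> \bar R) :
  (forall i, measurable (Q i)) -> (forall i, measurable (W i)) ->
  (forall x, measurable (V x)) ->
  (forall i, (0 <= c i)%R) -> (forall x, (0 <= u x)%R) ->
  (forall i x y, i \in l -> V x y -> Q i y -> W i x /\ (u x <= c i)%R) ->
  (forall i, i \in l -> (c i)%:E * nu (W i) <= H) ->
  measurable_fun setT phi -> (forall x, 0 <= phi x) ->
  forall E : set T, measurable E ->
  (forall y, E y -> exists2 i, i \in l & Q i y) ->
  exists g : T -> \bar R, [/\ measurable_fun setT g, forall x, 0 <= g x,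
    forall x, (u x)%:E * \int[mu]_(y in E `&` V x) phi y <= g x &
    \int[nu]_x g x <= H * \int[mu]_(y in E) phi y].
Proof.
move=> mQ mW mV c0 u0 hu hH mphi phi0.
elim: l hu hH => [|i l IH] hu hH E mE cov.
  have -> : E = set0 by apply/seteqP; split => // y /cov [].
  exists (cst 0); split => //= [x|]; first by rewrite set0I integral_set0 mule0.
  by rewrite integral0 integral_set0 mule0.
have [|||g [mg g0 gu gH]] := IH _ _ (E `\` Q i) (measurableD mE (mQ i)).
- by move=> j x y jl; apply: hu; rewrite inE jl orbT.
- by move=> j jl; apply: hH; rewrite inE jl orbT.
- move=> y [Ey nQ]; have [j] := cov y Ey.
  by rewrite inE => /predU1P[-> //|jl Qy]; exists j.
set F := \int[mu]_(y in E `&` Q i) phi y.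
have F0 : 0 <= F by apply: integral_ge0.
have H0 : 0 <= H by apply: le_trans (hH i _); rewrite ?inE ?eqxx // mule_ge0 // lee_fin.
have m1 : measurable_fun setT (fun x => (\1_(W i) x)%:E : \bar R).
  by apply/measurable_EFinP; exact: measurable_indic.
have m2 : measurable_fun setT (fun x => F * (\1_(W i) x)%:E).
  exact: measurable_funeM.
have m3 : measurable_fun setT (fun x => (c i)%:E * (F * (\1_(W i) x)%:E)).
  exact: measurable_funeM.
have p1 x : 0 <= (\1_(W i) x : R)%:E by rewrite lee_fin.
have p2 x : 0 <= F * (\1_(W i) x)%:E by rewrite mule_ge0.
have p3 x : 0 <= (c i)%:E * (F * (\1_(W i) x)%:E) by rewrite mule_ge0 // lee_fin.
(* The piece of [E] in [Q i] is seen only from points [x] of [W i], where [u x <= c i]; the rest of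
   [E] is handled by induction. *)
exists (fun x => (c i)%:E * (F * (\1_(W i) x)%:E) + g x); split.
- exact: emeasurable_funD.
- by move=> x; rewrite adde_ge0.
- move=> x; rewrite (ge0_integral_setID (mQ i)) //; last exact: measurableI.
  rewrite ge0_muleDr ?integral_ge0 //.
  apply: leeD; last by rewrite setDE setIAC -setDE.
  have [[y [[Ey Vy] Qy]]|/set0P/negP/negPn/eqP ->] := pselect (E `&` V x `&` Q i !=set0); last first.
    by rewrite integral_set0 mule0.
  have [Wx ux] := hu i x y ltac:(by rewrite inE eqxx) Vy Qy.
  rewrite indicE mem_set // mule1; apply: lee_pmul; rewrite ?lee_fin ?integral_ge0 //.
  apply: ge0_subset_integral => //; try by do 2? apply: measurableI.
    exact: measurable_funTS.
  by move=> z [[]].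
- rewrite ge0_integralD // (ge0_integralZl nu measurableT m2) ?lee_fin //.
  rewrite (ge0_integralZl nu measurableT m1) // (integral_indic nu measurableT) // setIT.
  rewrite (ge0_integral_setID (mQ i) mE) // ge0_muleDr ?integral_ge0 //.
  apply: leeD => //; rewrite -/F muleCA [leRHS]muleC; apply: lee_wpmul2l => //.
  by apply: hH; rewrite inE eqxx.
Qed.

End Discretize.

(** * Real powers, geometric series and Hoelder's inequality *)

Section PowR.
Context {R : realType}.
Implicit Types x y e : R.

Lemma powR_expR x e : 0 < x -> x `^ e = expR (e * ln x).
Proof. by move=> x0; rewrite /powR gt_eqF. Qed.

Lemma powR_anti x y e : 0 < x -> x <= y -> e <= 0 -> y `^ e <= x `^ e.
Proof.
move=> x0 xy e0; have y0 := lt_le_trans x0 xy.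
rewrite !powR_expR // ler_expR; apply: ler_wnM2l => //.
by rewrite ler_ln ?posrE.
Qed.

Lemma powR_mono x y e : 0 <= x -> x <= y -> 0 <= e -> x `^ e <= y `^ e.
Proof.
by move=> x0 xy e0; apply: ge0_ler_powR => //; rewrite nnegrE // (le_trans x0).
Qed.

Lemma powR_exprn x e (n : nat) : 0 < x -> (x ^+ n) `^ e = (x `^ e) ^+ n.
Proof.
move=> x0; elim: n => [|n IH]; first by rewrite !expr0 powR1.
by rewrite !exprS powRM ?IH // ?exprn_ge0 // ltW.
Qed.

Lemma powR_lt1 x e : 0 < x -> x < 1 -> 0 < e -> x `^ e < 1.
Proof.
move=> x0 x1 e0; rewrite powR_expR // -expR0 ltr_expR pmulr_rlt0 //.
by rewrite ln_lt0 // x0.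
Qed.

Lemma nneseries_geometric_le (C z : R) : 0 <= C -> 0 < z -> z < 1 ->
  (\sum_(0 <= k <oo) (C * z ^+ k)%:E <= (C / (1 - z))%:E)%E.
Proof.
move=> C0 z0 z1; apply: lime_le.
  by apply: is_cvg_nneseries => n _ _; rewrite lee_fin mulr_ge0 // exprn_ge0 // ltW.
apply: nearW => n; rewrite sumEFin lee_fin.
have := @geometric_le_lim R n C z C0 z0; rewrite gtr0_norm // => /(_ z1).
by rewrite /series /=.
Qed.

Lemma nneseries_term_le (u : nat -> \bar R) (k : nat) :
  (forall n, 0 <= u n)%E -> (u k <= \sum_(0 <= n <oo) u n)%E.
Proof.
move=> u0; rewrite (@nneseriesD1 _ _ k) //; apply: leeDl.
by apply: nneseries_ge0 => n *.
Qed.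

End PowR.

(* Hoelder's inequality with the constant [2]; it follows from the pointwise
   bound [b <= I (b / I) `^ p + I] with [I `^ p = Phi / M]. *)
Lemma integral_norm_le {R : realType} {d : measure_display}
    {T : measurableType d} (mu : {measure set T -> \bar R}) (E : set T)
    (f : T -> R) (p Phi M : R) :
  1 < p -> 0 < Phi -> 0 < M -> measurable E -> measurable_fun setT f ->
  (\int[mu]_(y in E) (`|f y| `^ p)%:E <= Phi%:E)%E -> (mu E <= M%:E)%E ->
  (\int[mu]_(y in E) `|f y|%:E <= (2 * Phi `^ p^-1 * M `^ (1 - p^-1))%:E)%E.
Proof.
move=> p1 Phi0 M0 mE mf hPhi hM.
have p0 : 0 < p by lra.
(* At this level the two terms of the bound both equal [Phi]^ p^-1 * M [^ (1 - p^-1)], whence the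
   factor 2. *)
pose I := (Phi / M) `^ p^-1.
have PM0 : 0 < Phi / M by rewrite divr_gt0.
have I0 : 0 < I by rewrite powR_gt0.
have mfn : measurable_fun setT (fun y => `|f y|) by exact: measurableT_comp.
have mfp : measurable_fun E (fun y => (`|f y| `^ p)%:E).
  apply/measurable_EFinP/measurable_funTS.
  exact: (measurableT_comp (measurable_powR p)).
have mc : measurable_fun E (fun y => (I `^ (1 - p))%:E * (`|f y| `^ p)%:E)%E.
  exact: measurable_funeM.
apply: (@le_trans _ _ (\int[mu]_(y in E)
    ((I `^ (1 - p))%:E * (`|f y| `^ p)%:E + I%:E))%E).
  apply: le_lower_integral => y _; first by rewrite lee_fin.
  rewrite -EFinM -EFinD lee_fin.
  have [fI|If] := leP `|f y| I.
    by apply: le_trans fI _; rewrite lerDr mulr_ge0 ?powR_ge0.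
  have fy0 := lt_trans I0 If.
  suff : `|f y| <= I `^ (1 - p) * `|f y| `^ p by lra.
  rewrite -[leLHS]powRr1 // -[X in _ `^ X](subrK p) powRD; last first.
    by rewrite (gt_eqF fy0) implybT.
  rewrite ler_wpM2r ?powR_ge0 //; apply: (powR_anti I0 (ltW If)).
  by lra.
rewrite ge0_integralD //; last 2 first.
- by move=> y _; rewrite -EFinM lee_fin mulr_ge0 ?powR_ge0.
- by move=> y _; rewrite lee_fin ltW.
rewrite ge0_integralZl ?lee_fin ?powR_ge0 //.
rewrite integral_cst //.
apply: (@le_trans _ _ ((I `^ (1 - p))%:E * Phi%:E + I%:E * M%:E)%E).
  by apply: leeD; apply: lee_wpmul2l => //; rewrite lee_fin ?powR_ge0 // ltW.
have PE : Phi = expR (ln Phi) by rewrite lnK ?posrE.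
have ME : M = expR (ln M) by rewrite lnK ?posrE.
have IE e : I `^ e = expR (e * (p^-1 * (ln Phi - ln M))).
  rewrite (powR_expR _ I0) /I (powR_expR _ PM0) ln_div ?posrE // expRK //.
have e1 : I `^ (1 - p) * Phi = Phi `^ p^-1 * M `^ (1 - p^-1).
  rewrite IE [X in _ * X = _]PE (powR_expR _ Phi0) (powR_expR _ M0) -!expRD.
  by congr expR; field; rewrite gt_eqF.
have e2 : I * M = Phi `^ p^-1 * M `^ (1 - p^-1).
  rewrite -(powRr1 (ltW I0)) IE [X in _ * X = _]ME.
  rewrite (powR_expR _ Phi0) (powR_expR _ M0) -!expRD.
  by congr expR; field; rewrite gt_eqF.
by rewrite -!EFinM -EFinD lee_fin e1 e2; lra.
Qed.

(** * Annular decomposition of the potential *)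

Section Potential.
Context {R : realType} {d : measure_display} {T : measurableType d}.
Context (rho : T -> T -> R) (mu : {measure set T -> \bar R}) (K D : R).
Hypothesis hD : doubling_space rho mu K D.
Notation B := (qball rho).
Notation m := (ball_mass rho mu).

Lemma exists_expn_gt (b z : R) : 2 <= b -> exists n, z < b ^+ n.
Proof.
move=> b2; exists (Num.bound `|z|); apply: le_lt_trans (ler_norm z) _.
apply: lt_le_trans (archi_boundP _) _ => //.
apply: (@le_trans _ _ (2 ^+ Num.bound `|z|)).
  by rewrite -natrX ler_nat ltnW // ltn_expl.
by apply: lerXn2r; rewrite ?nnegrE //; lra.
Qed.

Lemma expn_bracket (b z : R) : 2 <= b -> 1 <= z ->
  exists n, b ^+ n <= z < b ^+ n.+1.
Proof.
move=> b2 z1; have ex := exists_expn_gt z b2.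
case: (ex_minnP ex) => -[|n] hn hmin; first by move: hn; rewrite expr0; lra.
exists n; rewrite hn andbT leNgt; apply/negP => /hmin; by rewrite ltnn.
Qed.

(** The half-open side is switched because near annuli are located by the inverted ratio
    [r / rho y x]. *)
Lemma expn_bracketr (b z : R) : 2 <= b -> 1 < z ->
  exists n, b ^+ n < z <= b ^+ n.+1.
Proof.
move=> b2 z1.
have ex : exists n, z <= b ^+ n by have [n /ltW] := exists_expn_gt z b2; exists n.
case: (ex_minnP ex) => -[|n] hn hmin; first by move: hn; rewrite expr0; lra.
exists n; rewrite hn andbT ltNge; apply/negP => /hmin; by rewrite ltnn.
Qed.

(* [rho] is only quasi-symmetric, and [y |-> rho x y] need not be measurable;
   the kernel is therefore compared with a function of [rho y x]. *)
Lemma kernel_le alpha x y t : alpha < 1 -> 0 < t -> t <= rho y x ->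
  m x (rho x y) `^ (alpha - 1) <= (D^-1 * m x t) `^ (alpha - 1).
Proof.
move=> al1 t0 ty; have K0 := ds_K0 hD; have D0 := ds_D0 hD.
have tK : 0 < t / K by rewrite divr_gt0.
(* Applying [ds_tri] with [x] itself as the intermediate point turns it into quasi-symmetry. *)
have h : t / K <= rho x y.
  rewrite leNgt; apply/negP => xy.
  have : rho y x < K * (t / K).
    by apply: (ds_tri hD (z := x)); [right|left; rewrite (ds_refl hD)].
  by rewrite mulrCA divff ?gt_eqF // mulr1 ltNge ty.
apply: powR_anti; last by lra.
  by rewrite mulr_gt0 ?invr_gt0 // (ball_mass_gt0 hD).
rewrite ler_pdivrMl //; apply: le_trans (ler_wpM2l (ltW D0) (ball_mass_le hD x h)).
have := ball_mass_dbl hD 1 x tK.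
by rewrite !expr1 mulrCA divff ?gt_eqF // mulr1.
Qed.

(* Bounds the contribution of [t <= rho y x < K ^+ 3 * t] to the potential. *)
Definition annulus_term (alpha : R) (f : T -> R) (x : T) (t : R) : \bar R :=
  (((D^-1 * m x t) `^ (alpha - 1))%:E *
   \int[mu]_(y in B x (K ^+ 3 * t)) `|f y|%:E)%E.
Notation W := annulus_term.

(** Freezing the radius at [t] and extending the annulus to a full ball gives a measurable function
    of [y], with integral [annulus_term]. *)
Let ring_fun (alpha : R) (f : T -> R) (x : T) (t : R) (y : T) : \bar R :=
  (((D^-1 * m x t) `^ (alpha - 1))%:E *
   ((fun y => `|f y|%:E) \_ (B x (K ^+ 3 * t))) y)%E.

Let ring_fun_ge0 alpha f x t y : (0 <= ring_fun alpha f x t y)%E.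
Proof.
rewrite /ring_fun mule_ge0 ?lee_fin ?powR_ge0 // patchE.
by case: ifP => _; rewrite lee_fin.
Qed.

Let ring_meas (f : T -> R) x t : measurable_fun setT f ->
  measurable_fun setT ((fun y => `|f y|%:E) \_ (B x (K ^+ 3 * t)) : T -> \bar R).
Proof.
move=> mf; apply/(measurable_restrictT _ (ds_meas hD _ _)).1.
by apply/measurable_EFinP/measurable_funTS; exact: measurableT_comp.
Qed.

Let ring_fun_meas alpha (f : T -> R) x t : measurable_fun setT f ->
  measurable_fun setT (ring_fun alpha f x t).
Proof. by move=> mf; apply: measurable_funeM; exact: ring_meas. Qed.

Let integral_ring_fun alpha (f : T -> R) x t : measurable_fun setT f ->
  (\int[mu]_y ring_fun alpha f x t y = W alpha f x t)%E.
Proof.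
move=> mf; rewrite /ring_fun ge0_integralZl ?lee_fin ?powR_ge0 //.
- by rewrite -integral_mkcond.
- exact: ring_meas.
- by move=> y _; rewrite patchE; case: ifP => _; rewrite lee_fin.
Qed.

Let ring_fun_bound alpha (f : T -> R) x t y : alpha < 1 -> 0 < t -> t <= rho y x ->
  rho y x < K ^+ 3 * t ->
  (`|(f y * fine (mu (qball rho x (rho x y))) `^ (alpha - 1))%:E| <=
    ring_fun alpha f x t y)%E.
Proof.
move=> al1 t0 ty yt; rewrite /ring_fun patchE mem_set //= -EFinM lee_fin.
rewrite normrM mulrC (ger0_norm (powR_ge0 _ _)) ler_wpM2r //.
exact: kernel_le.
Qed.

Lemma potential_le alpha (f : T -> R) x r : alpha < 1 -> 0 < r -> measurable_fun setT f ->
  (`|K_alpha rho mu alpha f x| <=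
   \sum_(0 <= k <oo) W alpha f x (r / (K ^+ 3) ^+ k.+1) +
   \sum_(0 <= k <oo) W alpha f x ((K ^+ 3) ^+ k * r))%E.
Proof.
move=> al1 r0 mf; have K0 := ds_K0 hD.
have K3 : 2 <= K ^+ 3.
  by apply: le_trans (ds_K hD) _; rewrite -[leLHS]expr1 ler_weXn2l // (ds_K1 hD).
have K30 : 0 < K ^+ 3 by rewrite exprn_gt0.
(* With exponent [k.+1] the outermost near annulus ends at [r], exactly where the far annuli
   begin. *)
pose N y := (\sum_(0 <= k <oo) ring_fun alpha f x (r / (K ^+ 3) ^+ k.+1) y)%E.
pose F y := (\sum_(0 <= k <oo) ring_fun alpha f x ((K ^+ 3) ^+ k * r) y)%E.
have mN : measurable_fun setT N.
  apply: ge0_emeasurable_sum => [k y _ _|k _]; first exact: ring_fun_ge0.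
  exact: ring_fun_meas.
have mF : measurable_fun setT F.
  apply: ge0_emeasurable_sum => [k y _ _|k _]; first exact: ring_fun_ge0.
  exact: ring_fun_meas.
have N0 y : (0 <= N y)%E by apply: nneseries_ge0 => k _ _; exact: ring_fun_ge0.
have F0 y : (0 <= F y)%E by apply: nneseries_ge0 => k _ _; exact: ring_fun_ge0.
have -> : (\sum_(0 <= k <oo) W alpha f x (r / (K ^+ 3) ^+ k.+1) +
   \sum_(0 <= k <oo) W alpha f x ((K ^+ 3) ^+ k * r) = \int[mu]_y (N y + F y))%E.
  have IW (t : nat -> R) :
      (\int[mu]_y (\sum_(0 <= k <oo) ring_fun alpha f x (t k) y) =
       \sum_(0 <= k <oo) W alpha f x (t k))%E.
    rewrite (integral_nneseries mu measurableT); last 2 first.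
    - by move=> k; exact: ring_fun_meas.
    - by move=> k y _; exact: ring_fun_ge0.
    by apply: eq_eseriesr => k _; exact: integral_ring_fun.
  rewrite (ge0_integralD mu measurableT (fun y _ => N0 y) mN (fun y _ => F0 y) mF).
  by congr (_ + _)%E; apply/esym; [exact: (IW (fun k => r / (K ^+ 3) ^+ k.+1))|
    exact: (IW (fun k => (K ^+ 3) ^+ k * r))].
apply: abse_lower_integral_le => y.
(* At [y = x] the ball of radius 0 is empty, and 0 to the nonzero power [alpha - 1] is 0 by
   convention, so the integrand vanishes. *)
have [->|yx] := eqVneq y x.
  rewrite (ds_refl hD) (_ : qball rho x 0 = set0); last first.
    by apply/seteqP; split => // z; rewrite /qball /= ltNge (ds_ge0 hD).
  rewrite measure0 /= powR0; last by rewrite subr_eq0 lt_eqF.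
  by rewrite mulr0 normr0; exact: adde_ge0 (N0 x) (F0 x).
have d0 := ds_gt0 hD yx.
have [ry|yr] := leP r (rho y x).
- have [n /andP[h1 h2]] : exists n, (K ^+ 3) ^+ n <= rho y x / r < (K ^+ 3) ^+ n.+1.
    by apply: expn_bracket => //; rewrite ler_pdivlMr // mul1r.
  have t0 : 0 < (K ^+ 3) ^+ n * r by rewrite mulr_gt0 // exprn_gt0.
  apply: le_trans (ring_fun_bound f al1 t0 _ _) _.
  + by rewrite -ler_pdivlMr.
  + by rewrite mulrA -exprS -ltr_pdivrMr.
  apply: le_trans (nneseries_term_le n (fun k => ring_fun_ge0 _ _ _ _ _)) _.
  rewrite -/(F y); exact: leeDr (N0 y).
- have [n /andP[h1 h2]] : exists n, (K ^+ 3) ^+ n < r / rho y x <= (K ^+ 3) ^+ n.+1.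
    by apply: expn_bracketr => //; rewrite ltr_pdivlMr // mul1r.
  have e0 : 0 < (K ^+ 3) ^+ n.+1 by rewrite exprn_gt0.
  have t0 : 0 < r / (K ^+ 3) ^+ n.+1 by rewrite divr_gt0.
  apply: le_trans (ring_fun_bound f al1 t0 _ _) _.
  + by rewrite ler_pdivrMr // mulrC -ler_pdivrMr.
  + rewrite (exprS (K ^+ 3) n) invfM mulrCA (mulrA (K ^+ 3)) divff ?gt_eqF // mul1r.
    by rewrite ltr_pdivlMr ?exprn_gt0 // mulrC -ltr_pdivlMr.
  apply: le_trans (nneseries_term_le n (fun k => ring_fun_ge0 _ _ _ _ _)) _.
  rewrite -/(N y); exact: leeDl (F0 y).
Qed.

Lemma annulus_term_ge0 alpha f x t : (0 <= W alpha f x t)%E.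
Proof. by rewrite mule_ge0 ?lee_fin ?powR_ge0 // integral_ge0. Qed.

(** Hoelder's inequality on a ball of mass at most [D ^+ 3 * m x t]. [Phi] is left free: the far sum
    inserts the Morrey bound, the near sum a geometric mean. *)
Lemma annulus_term_le alpha p (f : T -> R) x t Phi : 1 < p -> 0 < t -> 0 < Phi ->
  measurable_fun setT f ->
  (\int[mu]_(y in B x (K ^+ 3 * t)) (`|f y| `^ p)%:E <= Phi%:E)%E ->
  (W alpha f x t <=
   ((D^-1) `^ (alpha - 1) * 2 * (D ^+ 3) `^ (1 - p^-1) *
     m x t `^ (alpha - p^-1) * Phi `^ p^-1)%:E)%E.
Proof.
move=> p1 t0 Phi0 mf hPhi; have D0 := ds_D0 hD; have K0 := ds_K0 hD.
have mt := ball_mass_gt0 hD x t0.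
have p10 : 0 < p^-1 by rewrite invr_gt0; lra.
have p11 : p^-1 < 1 by rewrite invf_lt1 //; lra.
have M0 : 0 < D ^+ 3 * m x t by rewrite mulr_gt0 // exprn_gt0.
have hM : (mu (B x (K ^+ 3 * t)) <= (D ^+ 3 * m x t)%:E)%E.
  by rewrite (ball_massE hD) lee_fin (ball_mass_dbl hD).
have h := integral_norm_le p1 Phi0 M0 (ds_meas hD x (K ^+ 3 * t)) mf hPhi hM.
apply: (le_trans (lee_wpmul2l _ h)); first by rewrite lee_fin powR_ge0.
rewrite -EFinM lee_fin (@powRM _ D^-1) ?(@powRM _ (D ^+ 3));
  rewrite ?invr_ge0 ?exprn_ge0 ?(ltW D0) ?(ltW mt) //.
rewrite le_eqVlt; apply/orP; left; apply/eqP.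
rewrite (_ : alpha - p^-1 = (alpha - 1) + (1 - p^-1)); last by ring.
rewrite (@powRD _ (m x t) (alpha - 1)); last by rewrite (gt_eqF mt) implybT.
by ring.
Qed.

End Potential.

(** * Sufficiency of the growth condition *)

Section Sufficiency.
Context {R : realType} {d : measure_display} {T : measurableType d}.
Context (rho : T -> T -> R) (mu nu : {measure set T -> \bar R}) (K D : R).
Hypothesis hD : doubling_space rho mu K D.
Context (p q alpha lam c : R).
Hypotheses (p1 : 1 < p) (pq : p < q) (al0 : 0 < alpha) (lam0 : 0 < lam)
  (lam1 : lam < 1 - alpha * p) (c0 : 0 < c).
Hypothesis hnu : forall a r, 0 < r ->
  (nu (qball rho a r) <= (c * fine (mu (qball rho a r)) `^ (q * (p^-1 - alpha)))%:E)%E.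
Notation B := (qball rho).
Notation m := (ball_mass rho mu).
Notation W := (annulus_term rho mu K D alpha).
Notation M := (K ^+ 3).
Notation g := (rd_const D).

(* [s] is the exponent of the growth condition on [nu]. Writing
   [1 / p = 1 / q + (1 / p - 1 / q)] and using the Morrey bound on the second
   share leaves a spare power [eps] of the mass; half of it makes the near sum
   converge and the other half, raised to [q], is [del]. The power [- eps']
   makes the far sum converge. *)
Let s := q * (p^-1 - alpha).
Let eps := lam * (p^-1 - q^-1).
Let del := eps * q / 2.
Let eps' := p^-1 - alpha - lam / p.

(** A bound [A] on the Morrey norm with the root cleared; [A] can be taken positive even when the
    norm is 0. *)
Definition morrey_le (A : R) (f : T -> R) : Prop := forall a r, 0 < r ->
  (\int[mu]_(y in B a r) (`|f y| `^ p)%:E <= (A `^ p * m a r `^ lam)%:E)%E.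

Let p0 : 0 < p. Proof. exact: lt_trans ltr01 p1. Qed.
Let q0 : 0 < q. Proof. exact: lt_trans p0 pq. Qed.
Let D0 : 0 < D. Proof. exact: ds_D0 hD. Qed.
Let K0 : 0 < K. Proof. exact: ds_K0 hD. Qed.
Let M0 : 0 < M. Proof. by rewrite exprn_gt0. Qed.
Let M1 : 1 <= M. Proof. exact: Kexp_ge1 hD 3. Qed.
Let g0 : 0 < g. Proof. exact: rd_const_gt0 hD. Qed.
Let g1 : g < 1. Proof. exact: rd_const_lt1 hD. Qed.

Let eps'0 : 0 < eps'.
Proof.
rewrite /eps' (_ : _ - _ = (1 - alpha * p - lam) / p); last by field; rewrite gt_eqF.
by rewrite divr_gt0 //; move: lam1; lra.
Qed.

Let eps0 : 0 < eps.
Proof. by rewrite /eps mulr_gt0 // subr_gt0 ltf_pV2. Qed.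

Let del0 : 0 < del. Proof. by rewrite /del divr_gt0 // mulr_gt0. Qed.

Let s0 : 0 < s.
Proof.
rewrite /s mulr_gt0 //.
have : 0 < lam / p by rewrite divr_gt0.
by move: eps'0 al0; rewrite /eps'; lra.
Qed.

(** This sign lets a lower bound on the mass bound the weight of the near part from above. It holds
    since [lam * (q - p) < 2 * q * (1 - alpha * p)]. *)
Let exp_le0 : del - s <= 0.
Proof.
rewrite /del /s /eps.
have -> : lam * (p^-1 - q^-1) * q / 2 - q * (p^-1 - alpha) =
    (lam * (q - p) - 2 * q * (1 - alpha * p)) / (2 * p).
  by field; rewrite !gt_eqF.
rewrite pmulr_lle0 ?invr_gt0 ?mulr_gt0 //.
move: p0 q0 pq lam0 lam1; nra.
Qed.

Lemma far_sum_le : exists2 C, 0 < C & forall A (f : T -> R), 0 < A ->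
  measurable_fun setT f -> morrey_le A f ->
  forall a r x, 0 < r -> rho x a < r ->
  (\sum_(0 <= k <oo) W f x (M ^+ k * r) <= (C * A * m a r `^ (- eps'))%:E)%E.
Proof.
pose C1 := (D^-1) `^ (alpha - 1) * 2 * (D ^+ 3) `^ (1 - p^-1).
pose C2 := C1 * (D ^+ 3) `^ (lam / p) * D `^ eps'.
have C10 : 0 < C1.
  by rewrite /C1 !mulr_gt0 ?powR_gt0 ?invr_gt0 ?exprn_gt0.
have D30 : 0 < D ^+ 3 by rewrite exprn_gt0.
have C20 : 0 < C2 by exact: mulr_gt0 (mulr_gt0 C10 (powR_gt0 _ D30)) (powR_gt0 _ D0).
have ge1 : g `^ eps' < 1 by exact: powR_lt1.
exists (C2 / (1 - g `^ eps')); first by rewrite divr_gt0 // subr_gt0.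
move=> A f A0 mf hA a r x r0 xa.
have ma := ball_mass_gt0 hD a r0.
rewrite (_ : _ * A * _ = (C2 * A * m a r `^ (- eps')) / (1 - g `^ eps')); last by ring.
apply: le_trans (nneseries_geometric_le _ (powR_gt0 _ g0) ge1); last first.
  by rewrite !mulr_ge0 ?powR_ge0 ?(ltW C20) ?(ltW A0).
apply: lee_nneseries => [k _ _|k _]; first exact: annulus_term_ge0.
have t0 : 0 < M ^+ k * r by rewrite mulr_gt0 // exprn_gt0.
have mt := ball_mass_gt0 hD x t0.
have Phi0 : 0 < A `^ p * (D ^+ 3 * m x (M ^+ k * r)) `^ lam.
  by rewrite mulr_gt0 ?powR_gt0 // mulr_gt0 // exprn_gt0.
have hPhi : (\int[mu]_(y in B x (M * (M ^+ k * r))) (`|f y| `^ p)%:E <=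
    (A `^ p * (D ^+ 3 * m x (M ^+ k * r)) `^ lam)%:E)%E.
  apply: le_trans (hA _ _ _) _; first by rewrite mulr_gt0.
  rewrite lee_fin ler_wpM2l ?powR_ge0 //; apply: powR_mono; rewrite ?ball_mass_ge0 ?(ltW lam0) //.
  exact: ball_mass_dbl.
apply: le_trans (annulus_term_le hD alpha p1 t0 Phi0 mf hPhi) _; rewrite lee_fin -/C1.
have -> : (A `^ p * (D ^+ 3 * m x (M ^+ k * r)) `^ lam) `^ p^-1 =
    A * (D ^+ 3) `^ (lam / p) * m x (M ^+ k * r) `^ (lam / p).
  rewrite powRM ?powR_ge0 // -!powRrM divff ?gt_eqF // powRr1 ?(ltW A0) //.
  by rewrite powRM ?exprn_ge0 ?ball_mass_ge0 ?(ltW D0) // mulrA.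
have -> : C1 * m x (M ^+ k * r) `^ (alpha - p^-1) *
    (A * (D ^+ 3) `^ (lam / p) * m x (M ^+ k * r) `^ (lam / p)) =
    C1 * (D ^+ 3) `^ (lam / p) * A * m x (M ^+ k * r) `^ (- eps').
  rewrite (_ : - eps' = (alpha - p^-1) + lam / p); last by rewrite /eps'; ring.
  by rewrite (@powRD _ (m _ _) (alpha - p^-1)) ?(gt_eqF mt) ?implybT //; ring.
have -> : C2 * A * m a r `^ (- eps') * (g `^ eps') ^+ k =
    C1 * (D ^+ 3) `^ (lam / p) * A * (D `^ eps' * (g `^ eps') ^+ k * m a r `^ (- eps')).
  by rewrite /C2; ring.
rewrite ler_wpM2l ?mulr_ge0 ?powR_ge0 ?(ltW C10) ?(ltW A0) //.
have Dg0 : 0 < D * g ^+ k by rewrite mulr_gt0 // exprn_gt0.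
have h : m a r / (D * g ^+ k) <= m x (M ^+ k * r).
  rewrite ler_pdivrMr //.
  apply: le_trans (ball_mass_compare hD r0 (or_intror xa)) _.
  rewrite mulrCA ler_pM2l // mulrC.
  exact: reverse_doubling_iter.
apply: le_trans (powR_anti _ h _) _; first by rewrite divr_gt0.
  by rewrite oppr_le0 ltW.
rewrite le_eqVlt; apply/orP; left; apply/eqP.
rewrite -powR_exprn // -powRM ?exprn_ge0 ?(ltW D0) ?(ltW g0) //.
rewrite !powR_expR ?divr_gt0 // ln_div ?posrE // -expRD.
by congr expR; ring.
Qed.

(* On each annulus the integral of [|f| `^ p] is bounded by a geometric mean of
   its weighted bound by [Z] and of its Morrey bound. *)
Lemma near_sum_le : exists2 C, 0 < C & forall A (f : T -> R), 0 < A ->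
  measurable_fun setT f -> morrey_le A f ->
  forall a r x Z, 0 < r -> rho x a < r -> 0 < Z ->
  (forall k, (m x (r / M ^+ k.+1) `^ (del - s))%:E *
     \int[mu]_(y in B x (M * (r / M ^+ k.+1))) (`|f y| `^ p)%:E <= Z%:E)%E ->
  (\sum_(0 <= k <oo) W f x (r / M ^+ k.+1) <=
   (C * A `^ (1 - p / q) * Z `^ q^-1 * m a r `^ (eps / 2))%:E)%E.
Proof.
pose C1 := (D^-1) `^ (alpha - 1) * 2 * (D ^+ 3) `^ (1 - p^-1).
pose C2 := C1 * (D ^+ 3) `^ eps * D `^ (eps / 2).
have C10 : 0 < C1.
  by rewrite /C1 !mulr_gt0 ?powR_gt0 ?invr_gt0 ?exprn_gt0.
have D30 : 0 < D ^+ 3 by rewrite exprn_gt0.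
have C20 : 0 < C2 by exact: mulr_gt0 (mulr_gt0 C10 (powR_gt0 _ D30)) (powR_gt0 _ D0).
have e20 : 0 < eps / 2 by rewrite divr_gt0.
have ge1 : g `^ (eps / 2) < 1 by exact: powR_lt1.
exists (C2 / (1 - g `^ (eps / 2))); first by rewrite divr_gt0 // subr_gt0.
move=> A f A0 mf hA a r x Z r0 xa Z0 hZ.
have ma := ball_mass_gt0 hD a r0.
set X := C2 * A `^ (1 - p / q) * Z `^ q^-1 * m a r `^ (eps / 2).
rewrite (_ : _ * _ * _ * _ = X / (1 - g `^ (eps / 2))); last by rewrite /X; ring.
apply: le_trans (nneseries_geometric_le _ (powR_gt0 _ g0) ge1); last first.
  by rewrite !mulr_ge0 ?powR_ge0 ?(ltW C20).
apply: lee_nneseries => [k _ _|k _]; first exact: annulus_term_ge0.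
have Mk0 : 0 < M ^+ k.+1 by rewrite exprn_gt0.
set t := r / M ^+ k.+1.
have t0 : 0 < t by rewrite divr_gt0.
have mt := ball_mass_gt0 hD x t0.
have hphi := hZ k; rewrite -/t in hphi.
pose P1 := m x t `^ (s - del) * Z.
pose P2 := A `^ p * (D ^+ 3 * m x t) `^ lam.
have Dm0 : 0 < D ^+ 3 * m x t by rewrite mulr_gt0 // exprn_gt0.
have P10 : 0 < P1 by rewrite mulr_gt0 // powR_gt0.
have P20 : 0 < P2 by rewrite mulr_gt0 // powR_gt0.
have h1 : (\int[mu]_(y in B x (M * t)) (`|f y| `^ p)%:E <= P1%:E)%E.
  have : ((m x t `^ (s - del))%:E * ((m x t `^ (del - s))%:E *
     \int[mu]_(y in B x (M * t)) (`|f y| `^ p)%:E) <= (m x t `^ (s - del))%:E * Z%:E)%E.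
    by apply: lee_wpmul2l; rewrite ?lee_fin ?powR_ge0.
  rewrite muleA -EFinM -powRD ?(gt_eqF mt) ?implybT //.
  by rewrite (_ : s - del + (del - s) = 0) ?powRr0 ?mul1e //; ring.
have h2 : (\int[mu]_(y in B x (M * t)) (`|f y| `^ p)%:E <= P2%:E)%E.
  apply: le_trans (hA _ _ _) _; first by rewrite mulr_gt0.
  rewrite lee_fin ler_wpM2l ?powR_ge0 //; apply: powR_mono; rewrite ?ball_mass_ge0 ?(ltW lam0) //.
  exact: ball_mass_dbl.
have th0 : 0 < p / q by rewrite divr_gt0.
have th1 : p / q < 1 by rewrite ltr_pdivrMr // mul1r.
pose P := P1 `^ (p / q) * P2 `^ (1 - p / q).
have P0 : 0 < P by rewrite mulr_gt0 // powR_gt0.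
have hP : (\int[mu]_(y in B x (M * t)) (`|f y| `^ p)%:E <= P%:E)%E.
  apply: (@le_trans _ _ (Num.min P1 P2)%:E); first by rewrite EFin_min le_min h1 h2.
  have mn0 : 0 < Num.min P1 P2 by rewrite lt_min P10.
  rewrite lee_fin -[leLHS]powRr1 ?(ltW mn0) // -[X in _ `^ X](subrKC (p / q)).
  rewrite powRD ?(gt_eqF mn0) ?implybT //.
  apply: ler_pM; rewrite ?powR_ge0 //; apply: powR_mono; rewrite ?(ltW mn0) ?ge_min ?lexx ?orbT //.
    exact: ltW.
  by move: th1; lra.
apply: le_trans (annulus_term_le hD alpha p1 t0 P0 mf hP) _; rewrite lee_fin -/C1.
(* The exponents of [m x t] sum to [alpha - p^-1 + (s - del) / q + eps = eps / 2], so the terms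
   decay as [t] shrinks. *)
have -> : C1 * m x t `^ (alpha - p^-1) * P `^ p^-1 =
    C1 * (D ^+ 3) `^ eps * A `^ (1 - p / q) * Z `^ q^-1 * m x t `^ (eps / 2).
  have lnP1 : ln P1 = (s - del) * ln (m x t) + ln Z.
    by rewrite lnM ?posrE ?powR_gt0 // ln_powR.
  have lnP2 : ln P2 = p * ln A + lam * (ln (D ^+ 3) + ln (m x t)).
    by rewrite lnM ?posrE ?powR_gt0 // !ln_powR lnM ?posrE.
  have lnP : ln P = p / q * ln P1 + (1 - p / q) * ln P2.
    by rewrite lnM ?posrE ?powR_gt0 // !ln_powR.
  rewrite -!(mulrA C1); congr (_ * _).
  rewrite (powR_expR _ P0) (powR_expR _ mt) (powR_expR _ A0) (powR_expR _ Z0).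
  rewrite (powR_expR _ D30) (powR_expR _ mt) lnP lnP1 lnP2 -!expRD; congr expR.
  rewrite /eps /del /s /eps; field; by rewrite !gt_eqF.
have -> : X * (g `^ (eps / 2)) ^+ k = C1 * (D ^+ 3) `^ eps * A `^ (1 - p / q) * Z `^ q^-1 *
    (D `^ (eps / 2) * (g `^ (eps / 2)) ^+ k * m a r `^ (eps / 2)).
  by rewrite /X /C2; ring.
rewrite ler_wpM2l ?mulr_ge0 ?powR_ge0 ?(ltW C10) //.
rewrite -powR_exprn // -!powRM ?mulr_ge0 ?exprn_ge0 ?(ltW D0) ?(ltW g0) ?ball_mass_ge0 //.
apply: powR_mono; rewrite ?ball_mass_ge0 ?(ltW e20) //.
have := reverse_doubling_iter hD k.+1 x t0.
rewrite /t mulrCA divff ?gt_eqF // mulr1 => /le_trans; apply.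
apply: (@le_trans _ _ (g ^+ k * m x r)).
  by rewrite ler_wpM2r ?ball_mass_ge0 // exprS ger_pMl ?exprn_gt0 // ltW.
rewrite (mulrC D) -mulrA ler_pM2l ?exprn_gt0 //.
exact: (ball_mass_compare hD r0 (or_introl xa)).
Qed.

(** [Z] is the sum over the scales of the majorants given by [discretize]. At scale [t] the weight,
    of exponent [del - s], times the [nu]-mass of a comparable ball is at most a multiple of the
    mass to the power [del], which is geometrically small in [k]. *)
Lemma near_majorant : exists2 C, 0 < C & forall A (f : T -> R), 0 < A ->
  measurable_fun setT f -> morrey_le A f -> forall a r, 0 < r ->
  exists Z : T -> \bar R, [/\ measurable_fun setT Z, forall x, (0 <= Z x)%E,
    forall x k, rho x a < r ->
      ((m x (r / M ^+ k.+1) `^ (del - s))%:E *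
       \int[mu]_(y in B x (M * (r / M ^+ k.+1))) (`|f y| `^ p)%:E <= Z x)%E &
    (\int[nu]_x Z x <= (C * A `^ p * m a r `^ (del + lam))%:E)%E].
Proof.
pose C1 := ((D ^+ 5)^-1) `^ (del - s) * (c * (D ^+ 4) `^ s).
pose C2 := C1 * (D ^+ 2) `^ del * D `^ lam.
have D50 : 0 < (D ^+ 5)^-1 by rewrite invr_gt0 exprn_gt0.
have C10 : 0 < C1.
  exact: mulr_gt0 (powR_gt0 _ D50) (mulr_gt0 c0 (powR_gt0 _ (exprn_gt0 4 D0))).
have C20 : 0 < C2.
  exact: mulr_gt0 (mulr_gt0 C10 (powR_gt0 _ (exprn_gt0 2 D0))) (powR_gt0 _ D0).
have gd1 : g `^ del < 1 by exact: powR_lt1.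
exists (C2 / (1 - g `^ del)); first by rewrite divr_gt0 // subr_gt0.
move=> A f A0 mf hA a r r0.
have mfp : measurable_fun setT (fun y => (`|f y| `^ p)%:E : \bar R).
  apply/measurable_EFinP; apply: (measurableT_comp (measurable_powR p)).
  exact: measurableT_comp.
pose E := B a (K * r).
have Kr0 : 0 < K * r by rewrite mulr_gt0.
have hE : (\int[mu]_(y in E) (`|f y| `^ p)%:E <= (A `^ p * (D * m a r) `^ lam)%:E)%E.
  apply: le_trans (hA _ _ Kr0) _; rewrite lee_fin ler_wpM2l ?powR_ge0 //.
  apply: powR_mono; rewrite ?ball_mass_ge0 ?(ltW lam0) //.
  by have := ball_mass_dbl hD 1 a r0; rewrite !expr1.
pose H k : R := C1 * ((D ^+ 2 * m a r) `^ del * (g `^ del) ^+ k).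
have step k : exists Zk : T -> \bar R, [/\ measurable_fun setT Zk,
    forall x, (0 <= Zk x)%E,
    forall x, ((m x (r / M ^+ k.+1) `^ (del - s))%:E *
       \int[mu]_(y in E `&` B x (M * (r / M ^+ k.+1))) (`|f y| `^ p)%:E <= Zk x)%E &
    (\int[nu]_x Zk x <= (H k)%:E * \int[mu]_(y in E) (`|f y| `^ p)%:E)%E].
  have Mk0 : 0 < M ^+ k.+1 by rewrite exprn_gt0.
  set t := r / M ^+ k.+1.
  have t0 : 0 < t by rewrite divr_gt0.
  have [l [hl cov]] := finite_cover hD a (K * r) t0.
  have Mt0 : 0 < M * t by rewrite mulr_gt0.
  have tMt : t <= M * t by rewrite ler_peMl // ltW.
  (* The second family of balls is large enough to contain every [x] for which [B x (M * t)] meets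
     the cover ball [B i t]. *)
  apply: (@discretize _ _ _ mu nu l (fun i => B i t) (fun i => B i (K * (M * t)))
    (fun x => B x (M * t)) (fun i => ((D ^+ 5)^-1 * m i t) `^ (del - s))
    (fun x => m x t `^ (del - s))) => //.
  - by move=> i; exact: (ds_meas hD).
  - by move=> i; exact: (ds_meas hD).
  - by move=> i; exact: (ds_meas hD).
  - by move=> i; exact: powR_ge0.
  - by move=> i; exact: powR_ge0.
  - move=> i x y il Vy Qy.
    have xi : rho x i < K * (M * t).
      apply: (ds_tri hD (z := y)); first by right.
      by left; exact: lt_le_trans Qy tMt.
    split => //; apply: powR_anti exp_le0.
      by rewrite mulr_gt0 ?invr_gt0 ?exprn_gt0 // (ball_mass_gt0 hD).
    (* Recentring from [i] at [x] needs the radius [K * (K * (M * t)) = K ^+ 5 * t], hence the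
       factor [D ^+ 5]. *)
    rewrite ler_pdivrMl ?exprn_gt0 //.
    apply: le_trans (ball_mass_dbl hD 5 x t0).
    rewrite (_ : K ^+ 5 * t = K * (K * (M * t))); last by ring.
    apply: le_trans (ball_mass_shift hD (or_intror xi)).
    by apply: (ball_mass_le hD); rewrite mulrA (mulrC K) -exprSr; rewrite ler_peMl ?(Kexp_ge1 hD) // ltW.
  - move=> i il; apply: le_trans (lee_wpmul2l _ (hnu i _)) _.
    + by rewrite lee_fin powR_ge0.
    + by rewrite mulr_gt0.
    rewrite -EFinM lee_fin.
    have mi := ball_mass_gt0 hD i t0.
    have h1 : m i (K * (M * t)) `^ s <= (D ^+ 4 * m i t) `^ s.
      apply: powR_mono; rewrite ?ball_mass_ge0 ?(ltW s0) //.
      by apply: le_trans (ball_mass_dbl hD 4 i t0); rewrite mulrA -exprS.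
    have h2 : m i t `^ del <= (D ^+ 2 * m a r) `^ del * (g `^ del) ^+ k.
      rewrite -powR_exprn // -powRM ?exprn_ge0 ?mulr_ge0 ?exprn_ge0 ?(ltW D0) ?(ltW g0) ?ball_mass_ge0 //.
      apply: powR_mono; rewrite ?ball_mass_ge0 ?(ltW del0) //.
      have := reverse_doubling_iter hD k.+1 i t0.
      rewrite /t (mulrCA (M ^+ k.+1)) divff ?gt_eqF // mulr1 => /le_trans; apply.
      apply: (@le_trans _ _ (g ^+ k * m i r)).
        by rewrite ler_wpM2r ?ball_mass_ge0 // exprS ger_pMl ?exprn_gt0 // ltW.
      rewrite mulrC ler_pM2r ?exprn_gt0 // expr2 -mulrA.
      apply: (@le_trans _ _ (m i (K * r))).
        by apply: (ball_mass_le hD); rewrite ler_peMl ?(ds_K1 hD) // ltW.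
      apply: le_trans (ball_mass_compare hD Kr0 (or_introl (hl _ il))) _.
      rewrite ler_pM2l //.
      by have := ball_mass_dbl hD 1 a r0; rewrite !expr1.
    apply: (@le_trans _ _ (((D ^+ 5)^-1 * m i t) `^ (del - s) * (c * (D ^+ 4 * m i t) `^ s))).
      by rewrite ler_wpM2l ?powR_ge0 // ler_wpM2l // ltW.
    rewrite (@powRM _ (D ^+ 5)^-1) ?invr_ge0 ?exprn_ge0 ?(ltW D0) ?(ltW mi) //.
    rewrite (@powRM _ (D ^+ 4)) ?exprn_ge0 ?(ltW D0) ?(ltW mi) //.
    rewrite (_ : _ * _ = C1 * (m i t `^ (del - s) * m i t `^ s)); last by rewrite /C1; ring.
    rewrite -powRD ?(gt_eqF mi) ?implybT // subrK.
    by rewrite ler_wpM2l // ltW.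
  - exact: (ds_meas hD).
have [Zk hZk] := choice step.
have Zk0 k x : (0 <= Zk k x)%E by have [_ h _ _] := hZk k.
have mZk k : measurable_fun setT (Zk k) by have [h _ _ _] := hZk k.
exists (fun x => \sum_(0 <= k <oo) Zk k x)%E; split.
- by apply: ge0_emeasurable_sum => [k x _ _|k _]; [exact: Zk0|exact: mZk].
- by move=> x; apply: nneseries_ge0 => k _ _; exact: Zk0.
- move=> x k xa; apply: le_trans (nneseries_term_le k (fun n => Zk0 n x)).
  have [_ _ h _] := hZk k; apply: le_trans (h x).
  have sub : B x (M * (r / M ^+ k.+1)) `<=` E.
    apply: (@subset_trans _ (B x r)); last exact: (ball_shift hD (or_introl xa)).
    apply: ball_sub; rewrite mulrCA (exprS M k) invfM (mulrA M) divff ?gt_eqF // mul1r.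
    by rewrite ler_piMr ?(ltW r0) // invf_le1 ?exprn_gt0 // exprn_ege1.
  by rewrite setIidr.
- rewrite (integral_nneseries nu measurableT) //.
  set F := A `^ p * (D * m a r) `^ lam.
  have F0 : 0 <= F by rewrite mulr_ge0 ?powR_ge0.
  have H0 k : 0 <= H k by rewrite /H !mulr_ge0 ?exprn_ge0 ?powR_ge0 // ltW.
  pose X := C1 * (D ^+ 2 * m a r) `^ del * F.
  apply: (@le_trans _ _ (\sum_(0 <= k <oo) (X * (g `^ del) ^+ k)%:E)%E).
    apply: lee_nneseries => [k _ _|k _]; first by apply: integral_ge0 => x _; exact: Zk0.
    have [_ _ _ h] := hZk k; apply: le_trans h _.
    apply: le_trans (lee_wpmul2l _ hE) _; first by rewrite lee_fin.
    by rewrite -EFinM lee_fin /H /X -/F le_eqVlt; apply/orP; left; apply/eqP; ring.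
  apply: le_trans (nneseries_geometric_le _ (powR_gt0 _ g0) gd1) _.
    by rewrite /X !mulr_ge0 ?powR_ge0 // ltW.
  have ma := ball_mass_gt0 hD a r0.
  rewrite lee_fin le_eqVlt; apply/orP; left; apply/eqP.
  rewrite /X /F /C2 (@powRM _ (D ^+ 2)) ?exprn_ge0 ?(ltW D0) ?(ltW ma) //.
  rewrite (@powRM _ D) ?(ltW D0) ?(ltW ma) //.
  rewrite (@powRD _ (m a r)) ?(gt_eqF ma) ?implybT //.
  by ring.
Qed.

(** The [q]-th power of near plus far part is below the measurable function [G * (Z + eta)]. Its
    integral is controlled by [near_majorant] for [Z] and by the growth condition for the constant
    [eta]. *)
Lemma local_bound : exists2 C, 0 < C & forall A (f : T -> R), 0 < A ->
  measurable_fun setT f -> morrey_le A f -> forall a r, 0 < r ->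
  (\int[nu]_(x in B a r) poweR `|K_alpha rho mu alpha f x| q <=
   (C * A `^ q * m a r `^ (q * (lam / p)))%:E)%E.
Proof.
have [Cf Cf0 far] := far_sum_le; have [Cn Cn0 near] := near_sum_le.
have [Cz Cz0 maj] := near_majorant.
have Cnf0 : 0 < Cn + Cf by rewrite addr_gt0.
exists ((Cn + Cf) `^ q * (Cz + c)).
  by rewrite mulr_gt0 ?powR_gt0 // addr_gt0.
move=> A f A0 mf hA a r r0.
have [Z [mZ Z0 hZ intZ]] := maj A f A0 mf hA a r r0.
have ma := ball_mass_gt0 hD a r0.
(* Chosen so that the far bound takes the form of the near bound with [eta] in place of [Z]. Adding
   it also makes the argument of the near bound positive. *)
pose eta := A `^ p * m a r `^ (- (eps' * q) - del).
have eta0 : 0 < eta by rewrite mulr_gt0 ?powR_gt0.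
pose G := (Cn + Cf) `^ q * A `^ (q - p) * m a r `^ del.
have G0 : 0 < G by rewrite !mulr_gt0 ?powR_gt0.
have qn0 : q != 0 by rewrite gt_eqF.
have bound x : B a r x ->
    (poweR `|K_alpha rho mu alpha f x| q <= G%:E * (Z x + eta%:E))%E.
  move=> xa; have al1 : alpha < 1.
    apply: lt_trans (_ : p^-1 < 1); last by rewrite invf_lt1 //.
    have : 0 < lam / p by rewrite divr_gt0.
    by move: eps'0; rewrite /eps'; lra.
  have := Z0 x; have := hZ x ^~ xa; case: (Z x) => [z| |] // hz z0; last first.
    by rewrite addye // gt0_muley ?lte_fin // leey.
  rewrite lee_fin in z0.
  have z1 : 0 < z + eta by rewrite ltr_wpDl.
  have hn := near A f A0 mf hA a r x _ r0 xa z1 (fun k => le_trans (hz k)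
    (_ : (z%:E <= (z + eta)%:E)%E)).
  have hf := far A f A0 mf hA a r x r0 xa.
  have hK : (`|K_alpha rho mu alpha f x| <=
      ((Cn + Cf) * A `^ (1 - p / q) * (z + eta) `^ q^-1 * m a r `^ (eps / 2))%:E)%E.
    apply: le_trans (potential_le hD x al1 r0 mf) _.
    apply: le_trans (leeD (hn _) hf) _; first by rewrite lee_fin lerDl ltW.
    rewrite -EFinD lee_fin -(mulrA Cf A).
    have -> : A * m a r `^ (- eps') =
        A `^ (1 - p / q) * eta `^ q^-1 * m a r `^ (eps / 2).
      rewrite (powR_expR _ eta0) !(powR_expR _ A0) !(powR_expR _ ma).
      rewrite /eta lnM ?posrE ?powR_gt0 // !ln_powR.
      rewrite -{1}(lnK (_ : A \is Num.pos)) ?posrE // -!expRD.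
      by congr expR; rewrite /del; field.
    have hez : eta `^ q^-1 <= (z + eta) `^ q^-1.
      by apply: powR_mono; rewrite ?(ltW eta0) ?invr_ge0 ?(ltW q0) // lerDr.
    have := ler_wpM2l (_ : 0 <= Cf * A `^ (1 - p / q) * m a r `^ (eps / 2)) hez.
    rewrite !mulr_ge0 ?powR_ge0 ?(ltW Cf0) // => /(_ isT).
    lra.
  apply: (@le_trans _ _ (poweR (((Cn + Cf) * A `^ (1 - p / q) * (z + eta) `^ q^-1 * m a r `^ (eps / 2))%:E) q)).
    by apply: gt0_ler_poweR; rewrite ?(ltW q0) // ?in_itv /= ?abse_ge0 ?leey // lee_fin !mulr_ge0 ?powR_ge0 // ltW.
  rewrite poweR_EFin -EFinD -EFinM lee_fin.
  rewrite !powRM ?mulr_ge0 ?powR_ge0 ?(ltW Cnf0) // -!powRrM mulVf // powRr1 ?(ltW z1) //.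
  rewrite mulrBl mul1r divfK // (_ : eps / 2 * q = del); last by rewrite /del; ring.
  by rewrite /G le_eqVlt; apply/orP; left; apply/eqP; ring.
have mB := ds_meas hD a r.
apply: (@le_trans _ _ (\int[nu]_(x in B a r) (G%:E * (Z x + eta%:E)))%E).
  by apply: le_lower_integral => // x _; exact: poweR_ge0.
have mZB : measurable_fun (B a r) Z by exact: measurable_funTS.
rewrite ge0_integralZl //; last 3 first.
- by apply: emeasurable_funD => //; exact: measurable_cst.
- by move=> x _; rewrite adde_ge0 // lee_fin ltW.
- by rewrite lee_fin ltW.
rewrite ge0_integralD //; last by move=> x _; rewrite lee_fin ltW.
rewrite integral_cst //.
have hZB : (\int[nu]_(x in B a r) Z x <= (Cz * A `^ p * m a r `^ (del + lam))%:E)%E.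
  by apply: le_trans intZ; apply: ge0_subset_integral.
have hnB : (eta%:E * nu (B a r) <= (eta * (c * m a r `^ s))%:E)%E.
  by rewrite EFinM; apply: lee_wpmul2l (hnu a r0); rewrite lee_fin ltW.
apply: le_trans (lee_wpmul2l _ (leeD hZB hnB)) _; first by rewrite lee_fin ltW.
rewrite -EFinD -EFinM lee_fin.
have -> : A `^ q = A `^ (q - p) * A `^ p.
  by rewrite -powRD ?(gt_eqF A0) ?implybT // subrK.
(* Both contributions scale alike: [2 * del + lam] and [s - eps' * q] equal [q * (lam / p)]. *)
have e1 : m a r `^ (q * (lam / p)) = m a r `^ del * m a r `^ (del + lam).
  rewrite -powRD ?(gt_eqF ma) ?implybT //; congr powR.
  by rewrite /del /eps; field; rewrite !gt_eqF.
have e2 : m a r `^ (q * (lam / p)) =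
    m a r `^ del * (m a r `^ (- (eps' * q) - del) * m a r `^ s).
  rewrite -!powRD ?(gt_eqF ma) ?implybT //; congr powR.
  by rewrite /eps' /s; field; rewrite !gt_eqF.
rewrite le_eqVlt; apply/orP; left; apply/eqP.
set Y := m a r `^ (q * (lam / p)) in e1 e2 *; set CC := (Cn + Cf) `^ q.
set A' := A `^ (q - p) * A `^ p.
rewrite (_ : CC * (Cz + c) * A' * Y = CC * Cz * A' * Y + CC * c * A' * Y); last by ring.
rewrite mulrDr /G /eta /A' /CC.
by congr (_ + _); [rewrite e1|rewrite e2]; ring.
Qed.

End Sufficiency.

(** * Morrey norms and indicators of balls *)

Section Morrey.
Context {R : realType} {d : measure_display} {T : measurableType d}.
Context (rho : T -> T -> R) (mu nu : {measure set T -> \bar R}) (K D : R).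
Hypothesis hD : doubling_space rho mu K D.
Notation B := (qball rho).
Notation m := (ball_mass rho mu).

Lemma poweRV_le (x : \bar R) (A p : R) : 0 < p -> 0 <= A -> (0 <= x)%E ->
  (poweR x p^-1 <= A%:E)%E = (x <= (A `^ p)%:E)%E.
Proof.
move=> p0 A0 x0; have pn0 : p != 0 by rewrite gt_eqF.
have mono e : 0 < e -> forall u v : \bar R, (0 <= u -> u <= v -> poweR u e <= poweR v e)%E.
  move=> e0 u v u0 uv; apply: gt0_ler_poweR; rewrite ?(ltW e0) ?in_itv //= ?leey ?andbT //.
  exact: le_trans uv.
apply/idP/idP => h.
- have := mono p p0 _ _ (poweR_ge0 _ _) h.
  by rewrite -poweRrM mulVf // poweRe1 // poweR_EFin.
- have pV : 0 < p^-1 by rewrite invr_gt0.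
  have := mono _ pV _ _ x0 h.
  by rewrite poweR_EFin -powRrM divff // powRr1.
Qed.

Lemma morrey_norm_ball_le (sigma : {measure set T -> \bar R}) (p lam A : R)
    (f : T -> \bar R) a r : 0 < p -> 0 <= A -> 0 < r ->
  (morrey_norm rho sigma mu p lam f <= A%:E)%E ->
  (\int[sigma]_(x in B a r) poweR `|f x| p <= (A `^ p * m a r `^ lam)%:E)%E.
Proof.
move=> p0 A0 r0 hA.
have i0 : (0 <= \int[sigma]_(x in B a r) poweR `|f x| p)%E.
  by apply: integral_ge0 => x _; exact: poweR_ge0.
have ma := ball_mass_gt0 hD a r0.
have : (poweR ((m a r `^ (- lam))%:E * \int[sigma]_(x in B a r) poweR `|f x| p) p^-1 <= A%:E)%E.
  by apply: le_trans hA; apply: ereal_sup_ubound; exists a, r.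
rewrite poweRV_le // ?mule_ge0 ?lee_fin ?powR_ge0 // => h.
have := lee_wpmul2l (_ : (0 <= (m a r `^ lam)%:E)%E) h.
rewrite lee_fin powR_ge0 muleA -EFinM -powRD ?(gt_eqF ma) ?implybT // subrr.
by rewrite powRr0 mul1e mulrC -EFinM; exact.
Qed.

Lemma morrey_norm_le (sigma : {measure set T -> \bar R}) (p lam A : R)
    (f : T -> \bar R) : 0 < p -> 0 <= A ->
  (forall a r, 0 < r ->
    (\int[sigma]_(x in B a r) poweR `|f x| p <= (A `^ p * m a r `^ lam)%:E)%E) ->
  (morrey_norm rho sigma mu p lam f <= A%:E)%E.
Proof.
move=> p0 A0 h; apply: ge_ereal_sup => _ [a [r [r0 ->]]].
have ma := ball_mass_gt0 hD a r0.
rewrite poweRV_le // ?mule_ge0 ?lee_fin ?powR_ge0 //; last first.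
  by apply: integral_ge0 => x _; exact: poweR_ge0.
apply: le_trans (lee_wpmul2l _ (h a r r0)) _; first by rewrite lee_fin powR_ge0.
rewrite -EFinM lee_fin mulrCA -powRD ?(gt_eqF ma) ?implybT // addNr powRr0.
by rewrite mulr1.
Qed.

(** A point is the intersection of its balls of radius [1 / (n + 1)]. This allows the centre to be
    removed from a ball in [potential_indic_ge]. *)
Lemma measurable_qset1 (x : T) : measurable [set x].
Proof.
have -> : [set x] = \bigcap_n B x n.+1%:R^-1.
  apply/seteqP; split => [_ -> n _|y hy]; first by rewrite /qball /= (ds_refl hD).
  apply/eqP; apply/negPn/negP => yx.
  have d0 := ds_gt0 hD yx.
  have := hy (Num.bound (rho y x)^-1) Logic.I; rewrite /qball /= ltNge => /negP; apply.
  rewrite -[leRHS]invrK lef_pV2 ?posrE ?invr_gt0 //.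
  apply: le_trans (ltW (archi_boundP _)) _; first by rewrite invr_ge0 ltW.
  by rewrite ler_nat.
by apply: bigcap_measurable => // n _; exact: (ds_meas hD).
Qed.

(** The intersection of two balls has mass at most the smaller of their masses, hence at most the
    geometric mean with weights [1 - lam] and [lam]. *)
Lemma morrey_norm_indic (p lam : R) a r : 1 < p -> 0 < lam -> lam < 1 -> 0 < r ->
  (morrey_norm rho mu mu p lam (EFin \o \1_(B a r)) <=
   (m a r `^ ((1 - lam) / p))%:E)%E.
Proof.
move=> p1 lam0 lam1 r0; have p0 : 0 < p by lra.
have ma := ball_mass_gt0 hD a r0.
apply: morrey_norm_le => //; first exact: powR_ge0.
move=> b t t0; have mb := ball_mass_gt0 hD b t0.
have -> : (\int[mu]_(x in B b t) poweR `|(EFin \o \1_(B a r)) x| p =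
    \int[mu]_(x in B b t) (\1_(B a r) x)%:E)%E.
  apply: eq_integral => x _; rewrite /= indicE; case: (x \in _) => /=.
    by rewrite normr1 powR1.
  by rewrite normr0 powR0 ?gt_eqF.
rewrite integral_indic; try exact: (ds_meas hD).
rewrite -powRrM divfK ?gt_eqF //.
have sa : (mu (B a r `&` B b t) <= (m a r)%:E)%E.
  rewrite -(ball_massE hD); apply: le_measure; rewrite ?inE; try exact: (ds_meas hD).
    by apply: measurableI; exact: (ds_meas hD).
  exact: subIsetl.
have sb : (mu (B a r `&` B b t) <= (m b t)%:E)%E.
  rewrite -(ball_massE hD); apply: le_measure; rewrite ?inE; try exact: (ds_meas hD).
    by apply: measurableI; exact: (ds_meas hD).
  exact: subIsetr.
have [ba|ab] := leP (m b t) (m a r).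
- apply: le_trans sb _; rewrite lee_fin.
  have {1}-> : m b t = m b t `^ (1 - lam) * m b t `^ lam.
    by rewrite -powRD ?(gt_eqF mb) ?implybT // subrK powRr1 // ltW.
  by rewrite ler_wpM2r ?powR_ge0 //; apply: powR_mono; rewrite ?(ltW mb) //; lra.
- apply: le_trans sa _; rewrite lee_fin.
  have {1}-> : m a r = m a r `^ (1 - lam) * m a r `^ lam.
    by rewrite -powRD ?(gt_eqF ma) ?implybT // subrK powRr1 // ltW.
  by rewrite ler_wpM2l ?powR_ge0 //; apply: powR_mono; rewrite ?(ltW ma) ?(ltW ab) //; lra.
Qed.

(** For [x] and [y] in the ball, [B x (rho x y)] has mass at most [D ^+ 2 * m a r], which bounds the
    kernel from below. At [y = x] the kernel takes the value 0, so this null point is removed. *)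
Lemma potential_indic_ge (alpha : R) a r x : alpha < 1 -> mu [set x] = 0%E ->
  0 < r -> B a r x ->
  (((D ^+ 2) `^ (alpha - 1) * m a r `^ alpha)%:E <=
   K_alpha rho mu alpha (\1_(B a r)) x)%E.
Proof.
move=> al1 mx0 r0 xa; have D0 := ds_D0 hD; have K0 := ds_K0 hD.
have ma := ball_mass_gt0 hD a r0.
have mB := ds_meas hD a r; have mx := measurable_qset1 x.
have mBx : measurable (B a r `\ x) by exact: measurableD.
pose k := (D ^+ 2 * m a r) `^ (alpha - 1).
apply: (@le_trans _ _ (\int[mu]_y (k%:E * (\1_(B a r `\ x) y)%:E))%E).
  rewrite ge0_integralZl ?lee_fin ?powR_ge0 //; last first.
    by apply/measurable_EFinP; exact: measurable_indic.
  rewrite integral_indic // setIT.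
  have hm : ((m a r)%:E <= mu (B a r `\ x))%E.
    rewrite -(ball_massE hD).
    have {1}-> : B a r = (B a r `\ x) `|` [set x].
      by apply/seteqP; split => [y hy|y [[]//|->//]]; have [->|yx] := eqVneq y x; [right|left; split => //; exact/eqP].
    apply: le_trans (measureU2 _ mBx mx) _.
    rewrite -[leRHS]adde0; apply: leeD => //.
    have mx00 : (mu [set x] <= 0)%E by rewrite mx0.
    exact: mx00.
  apply: le_trans (lee_wpmul2l _ hm); last by rewrite lee_fin powR_ge0.
  rewrite -EFinM lee_fin /k (@powRM _ (D ^+ 2)) ?exprn_ge0 ?(ltW D0) ?(ltW ma) //.
  rewrite -mulrA -{3}(@powRr1 _ (m a r)) ?(ltW ma) //.
  by rewrite -powRD ?(gt_eqF ma) ?implybT // subrK.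
apply: le_lower_integral => y _; first by rewrite -EFinM lee_fin mulr_ge0 ?powR_ge0.
rewrite -EFinM lee_fin !indicE in_setD in_set1.
have [ya|] := boolP (y \in B a r); last by rewrite mulr0 mul0r.
have [->|yx] := eqVneq y x; first by rewrite mulr0 mul1r powR_ge0.
rewrite mulr1 mul1r inE in ya *.
have xy : rho x y < K * r by apply: (ds_tri hD (z := a)); [left|right].
apply: powR_anti; last by lra.
  by apply: (ball_mass_gt0 hD); rewrite (ds_gt0 hD) // eq_sym.
apply: le_trans (ball_mass_dbl hD 2 a r0).
apply: le_trans (ball_mass_le hD x (ltW xy)) _.
rewrite expr2 -mulrA; apply: (ball_mass_shift hD).
left; apply: lt_le_trans xa _; rewrite ler_peMl ?(ds_K1 hD) //; exact: ltW.
Qed.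

End Morrey.

(** * Equivalence of boundedness and the growth condition *)

Theorem theorem3p1 (R : realType) (d : measure_display) (T : measurableType d)
    (op : set (set T)) (rho : T -> T -> R) (mu nu : {measure set T -> \bar R})
    (p q alpha lam1 lam2 : R) :
  homogeneous_type op rho mu ->
  1 < p -> p < q ->
  0 < alpha -> alpha < p^-1 ->
  0 < lam1 -> lam1 < 1 - alpha * p ->
  lam2 / q = lam1 / p ->
  K_alpha_bounded rho nu mu alpha p lam1 q lam2 <->
  exists2 c : R, 0 < c &
    forall (a : T) (r : R), 0 < r ->
      (nu (qball rho a r) <= (c * fine (mu (qball rho a r)) `^ (q * (p^-1 - alpha)))%:E)%E.
Proof.
move=> hom p1 pq al0 alp lam0 lam1lt lam2E.
have mu1 x : mu [set x] = 0%E by case: hom => [_ [_ [_ [_ [_ [_ [_ [_ [_ [_ [_ [? _]]]]]]]]]]]].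
have [K [D hD]] := homogeneous_doubling_space hom.
have D0 := ds_D0 hD.
have p0 : 0 < p by lra.
have q0 : 0 < q by lra.
have qn0 : q != 0 by rewrite gt_eqF.
have lam2q : lam2 = q * (lam1 / p) by rewrite -lam2E mulrC divfK.
have al1 : alpha < 1 by apply: lt_trans alp _; rewrite invf_lt1.
have lam11 : lam1 < 1 by have := mulr_gt0 al0 p0; lra.
split=> [[C hC]|[c c0 hnu]].
(* The constant of [K_alpha_bounded] carries no sign; a positive one is needed for real powers and
   logarithms. *)
- pose C' := Num.max C 1.
  have C'0 : 0 < C' by rewrite lt_max ltr01 orbT.
  pose k0 := (D ^+ 2) `^ (alpha - 1).
  have k00 : 0 < k0 by rewrite powR_gt0 // exprn_gt0.
  exists (C' `^ q / k0 `^ q); first by rewrite divr_gt0 // powR_gt0.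
  move=> a r r0; have ma := ball_mass_gt0 hD a r0.
  rewrite -[fine _]/(ball_mass rho mu a r).
  set m := ball_mass rho mu a r in ma *.
  pose f0 : T -> R := \1_(qball rho a r).
  have hf : (morrey_norm rho mu mu p lam1 (EFin \o f0) <= (m `^ ((1 - lam1) / p))%:E)%E.
    exact: (morrey_norm_indic hD a p1 lam0 lam11 r0).
  have hb : (morrey_norm rho nu mu q lam2 (K_alpha rho mu alpha f0) <=
      (C' * m `^ ((1 - lam1) / p))%:E)%E.
    have fin := le_lt_trans hf (ltry _).
    have mf0 : measurable_fun setT f0.
      by apply: measurable_indic; exact: (ds_meas hD).
    apply: le_trans (hC f0 mf0 fin) _.
    have n0 : (0 <= morrey_norm rho mu mu p lam1 (EFin \o f0))%E.
      by apply: le_trans (poweR_ge0 _ _) _; last (apply: ereal_sup_ubound; exists a, r).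
    apply: (@le_trans _ _ (C'%:E * morrey_norm rho mu mu p lam1 (EFin \o f0))%E).
      by apply: lee_wpmul2r => //; rewrite lee_fin le_max lexx.
    by rewrite EFinM; apply: lee_wpmul2l => //; rewrite lee_fin ltW.
  have B0 : 0 <= C' * m `^ ((1 - lam1) / p) by rewrite mulr_ge0 ?powR_ge0 // ltW.
  have := morrey_norm_ball_le hD a q0 B0 r0 hb; rewrite -/m => hint.
  have low : (((k0 * m `^ alpha) `^ q)%:E * nu (qball rho a r) <=
      \int[nu]_(x in qball rho a r) poweR `|K_alpha rho mu alpha f0 x| q)%E.
    rewrite -integral_cst; last exact: (ds_meas hD).
    apply: le_lower_integral => x xa; first by rewrite lee_fin powR_ge0.
    have h := potential_indic_ge hD al1 (mu1 x) r0 xa.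
    rewrite -poweR_EFin; apply: gt0_ler_poweR; rewrite ?(ltW q0) // ?in_itv /= ?leey ?abse_ge0 ?andbT //.
      by rewrite lee_fin mulr_ge0 ?powR_ge0.
    exact: le_trans h (lee_abs _).
  have := le_trans low hint.
  have km0 : 0 < (k0 * m `^ alpha) `^ q by rewrite powR_gt0 // mulr_gt0 // powR_gt0.
  rewrite -lee_pdivlMl // => /le_trans; apply.
  (* The exponent of the mass is [q * (1 - lam1) / p + lam2 - alpha * q], which is
     [q * (p^-1 - alpha)] by the relation between [lam1] and [lam2]. *)
  rewrite -EFinM lee_fin le_eqVlt; apply/orP; left; apply/eqP.
  rewrite !(powR_expR _ C'0) !(powR_expR _ k00) !(powR_expR _ ma).
  rewrite -(lnK (C'0 : C' \is Num.pos)) -{1}(lnK (k00 : k0 \is Num.pos)) -!expRD.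
  rewrite !(powR_expR _ (expR_gt0 _)) !expRK -!expRN -!expRD lam2q; congr expR.
  by field; rewrite gt_eqF.
- have [C C0 hC] := local_bound hD p1 pq al0 lam0 lam1lt c0 hnu.
  exists (C `^ q^-1) => f mf ffin.
  apply: ge_ereal_sup => _ [a [r [r0 ->]]].
  set N := morrey_norm rho mu mu p lam1 (EFin \o f) in ffin *.
  have N0 : (0 <= N)%E.
    by apply: le_trans (poweR_ge0 _ _) _; last (apply: ereal_sup_ubound; exists a, r).
  have [n NE] : exists n, N = n%:E.
    by exists (fine N); rewrite fineK // ge0_fin_numE.
  have n0 : 0 <= n by rewrite NE lee_fin in N0.
  have Cq0 : 0 < C `^ q^-1 by rewrite powR_gt0.
  (* [local_bound] requires a positive Morrey bound while the norm may be 0. The norm is enlarged so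
     that the final bound grows by exactly [e]. *)
  rewrite NE -EFinM; apply/lee_addgt0Pr => e e0.
  pose A := n + e / C `^ q^-1.
  have A0 : 0 < A by rewrite ltr_wpDl // divr_gt0.
  have nA : (N <= A%:E)%E by rewrite NE lee_fin lerDl ltW // divr_gt0.
  have hA : morrey_le rho mu p lam1 A f.
    move=> b t t0; have h := morrey_norm_ball_le hD b p0 (ltW A0) t0 nA.
    apply: le_trans h; rewrite le_eqVlt; apply/orP; left; apply/eqP.
    exact: eq_integral.
  rewrite -EFinD (_ : _ + e = C `^ q^-1 * A); last by rewrite /A mulrDr mulrCA divff ?mulr1 // gt_eqF.
  apply: le_trans (_ : morrey_norm rho nu mu q lam2 (K_alpha rho mu alpha f) <= _)%E.
    by apply: ereal_sup_ubound; exists a, r.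
  apply: (morrey_norm_le hD) => //; first by rewrite mulr_ge0 ?ltW.
  move=> b t t0; apply: le_trans (hC A f A0 mf hA b t t0) _.
  rewrite lee_fin powRM ?(ltW Cq0) ?(ltW A0) // -powRrM mulVf // powRr1 ?(ltW C0) //.
  by rewrite lam2q.
Qed.
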